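(* Let $V$ be an $n$-dimensional left vector space over a division ring $R$ and $V'$ an $n'$-dimensional left vector space over a division ring $R'$, and let $1\le k\le n-1$, $1\le k'\le n'-1$. Every $J$-mapping $f:\mathcal{G}_k(V)\to\mathcal{G}_{k'}(V')$ is an isometric embedding of the Grassmann graph $\Gamma_k(V)$ in the Grassmann graph $\Gamma_{k'}(V')$.
   Context: $\mathcal{G}_k(V)$ denotes the set of $k$-dimensional subspaces of $V$. For $1\le k\le n-1$ the Grassmann graph $\Gamma_k(V)$ has vertex set $\mathcal{G}_k(V)$, two vertices being adjacent iff their intersection is $(k-1)$-dimensional; its graph distance is $d(S,U)=k-\dim(S\cap U)$. The Johnson graph $J(n,k)$ has as vertices the $k$-element subsets of $\{1,\dots,n\}$, two being adjacent iff they meet in $k-1$ elements. An isometric embedding of a graph in another graph is an injective map between the vertex sets preserving graph distance. An apartment of $\mathcal{G}_k(V)$ is the set of all $k$-dimensional subspaces spanned by subsets of a fixed basis of $V$. A $J(n,k)$-subset of $\mathcal{G}_{k'}(V')$ is the image of an isometric embedding of $J(n,k)$ in $\Gamma_{k'}(V')$. A map $f:\mathcal{G}_k(V)\to\mathcal{G}_{k'}(V')$ is a $J$-mapping if it sends every apartment of $\mathcal{G}_k(V)$ onto a $J(n,k)$-subset of $\mathcal{G}_{k'}(V')$. *)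

(* Defs.v *)
From mathcomp Require Import all_boot all_order all_algebra.
From mathcomp Require Import boolp classical_sets.

Set Implicit Arguments.
Unset Strict Implicit.
Unset Printing Implicit Defensive.

Import GRing.Theory.

Local Open Scope ring_scope.
Local Open Scope classical_set_scope.

Definition division_ring (R : unitRingType) : Prop :=
  forall x : R, x != 0 -> x \is a GRing.unit.

(* MathComp's {vspace V}, span and free require a commutative field of
   scalars, so linear algebra over a division ring is set up here on sets of
   vectors. *)
Section LinearAlgebra.
Variables (R : nzRingType) (V : lmodType R).

Definition subspace (S : set V) : Prop := GRing.submod_closed [in S].

Definition lspan (A : set V) : set V := smallest subspace A.

Definition lin_indep (d : nat) (b : 'I_d -> V) : Prop :=
  forall c : 'I_d -> R, \sum_(i < d) c i *: b i = 0 -> forall i, c i = 0.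

Definition is_basis (S : set V) (d : nat) (b : 'I_d -> V) : Prop :=
  lin_indep b /\ lspan (range b) = S.

(* This entails that S is a subspace. *)
Definition has_dim (d : nat) (S : set V) : Prop :=
  exists b : 'I_d -> V, is_basis S b.

End LinearAlgebra.

(* A graph is given by its adjacency relation; y is at distance d from x when
   d is the least length of a path from x to y. A relation rather than a
   function, so that vertices in different components have no distance. *)
Definition is_dist (T : Type) (e : rel T) (x y : T) (d : nat) : Prop :=
  (exists p : seq T, [/\ path e x p, last x p = y & size p = d]) /\
  (forall p : seq T, path e x p -> last x p = y -> (d <= size p)%N).

Definition isometric_embedding (T U : Type) (e : rel T) (e' : rel U)
    (g : T -> U) : Prop :=
  injective g /\
  forall (x y : T) (d : nat), is_dist e x y d <-> is_dist e' (g x) (g y) d.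

Definition johnson (n k : nat) : Type := {A : {set 'I_n} | #|A| == k}.

Definition johnson_adj (n k : nat) : rel (johnson n k) :=
  fun A B => #|(val A :&: val B)%SET| == k.-1.

Section Grassmann.
Variables (R : nzRingType) (V : lmodType R).

Definition grassmannian (k : nat) : set (set V) := [set S | has_dim k S].

Definition grassmann_adj (k : nat) : rel (grassmannian k) :=
  fun S U => `[< has_dim k.-1 (val S `&` val U) >].

Definition apartment (n k : nat) (A : set (grassmannian k)) : Prop :=
  exists2 b : 'I_n -> V, is_basis [set: V] b &
    A = [set S : grassmannian k |
          exists I : {set 'I_n}, val S = lspan (b @` [set` I])].

Definition J_subset (n m k : nat) (X : set (grassmannian k)) : Prop :=
  exists2 g : johnson n m -> grassmannian k,
    isometric_embedding (@johnson_adj n m) (@grassmann_adj k) g & X = range g.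

End Grassmann.

Arguments grassmannian {R} V k.
Arguments grassmann_adj {R} V k.

Definition J_mapping (n k k' : nat) (R R' : nzRingType)
    (V : lmodType R) (V' : lmodType R')
    (f : grassmannian V k -> grassmannian V' k') : Prop :=
  forall A : set (grassmannian V k), apartment n A -> J_subset n k (f @` A).

(* Main.v *)
Require Import Defs.
From mathcomp Require Import all_boot all_order all_algebra.
From mathcomp Require Import boolp classical_sets.
From mathcomp Require Import fintype finset.
From mathcomp Require Import zify.

(** Any two vertices of the Grassmann graph lie in a common apartment, and a
    J-mapping f is a bijection from an apartment onto a J(n,k)-subset, so f is
    injective and it remains to see that this bijection preserves distances.

    For i <> j replace b_i by b_i + b_j, respectively b_j by b_i + b_j, in a
    basis b.  The three apartments A, B, C so obtained are such that each is
    contained in the union of the other two, and A \ B consists of the subspaces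
    whose index set contains i but not j.  If f (A \ B) again consists of the
    vertices of f(A) whose index set contains some u but not some v, then
    distances are preserved, because the number of pairs (i,j) separating both
    I and J from the rest is |I :&: J| * |~: (I :|: J)|, which determines the
    distance.

    In an isometric image of J(n,k) the cliques {I | M c I}, |M| = k - 1, all go
    into stars or all go into tops.  Assume 2k <= n by complementing indices.
    An image of star type is spanned by n points, any 2k of which are
    independent, over a common subspace; each point is a meet of those members
    of a subfamily indexed by sets containing i, as soon as the subfamily meets
    {I | i in I, j notin I} for every j <> i.  So two distinct images of star
    type must differ on a whole set {I | u in I, v notin I}.  Duality exchanges
    stars and tops, and for n = 2k so does complementation.  For n > 2k the
    three images have the same type: if f(A) is of top type and f(B), f(C) are
    of star type, then all members of f(A) \ f(C) lie above one point p; some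
    hyperplane q_j of f(A) does not contain p, and a clique {I | M c I} of f(A)
    with j in M then lies in f(C) below an element of rank k' + 1, although it
    has n - k + 1 > k + 1 members.

    Only the modular lattice of subspaces of V' and its rank function matter on
    the target side, which makes the duality available. *)

Set Implicit Arguments.
Unset Strict Implicit.
Unset Printing Implicit Defensive.

Import GRing.Theory.

(** * Ranked modular lattices and Johnson graphs in them *)

(** The axioms are stable under reversing the order; [rk_bound] is carried along so that
    [rk_bound - rk] can serve as the rank of the dual. Antisymmetry is contained in [rk_eq]. *)
Record ranked_lattice := RankedLattice {
  carrier :> Type;
  lle : carrier -> carrier -> Prop;
  meet : carrier -> carrier -> carrier;
  join : carrier -> carrier -> carrier;
  rk : carrier -> nat;
  rk_bound : nat;
  lle_refl : forall x, lle x x;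
  lle_trans : forall y x z, lle x y -> lle y z -> lle x z;
  meetl : forall x y, lle (meet x y) x;
  meetr : forall x y, lle (meet x y) y;
  meet_glb : forall x y z, lle z x -> lle z y -> lle z (meet x y);
  joinl : forall x y, lle x (join x y);
  joinr : forall x y, lle y (join x y);
  join_lub : forall x y z, lle x z -> lle y z -> lle (join x y) z;
  rk_le : forall x y, lle x y -> rk x <= rk y;
  rk_eq : forall x y, lle x y -> rk y <= rk x -> x = y;
  rk_modular : forall x y, rk (meet x y) + rk (join x y) = rk x + rk y;
  rk_max : forall x, rk x <= rk_bound }.

Arguments lle {r}.
Arguments meet {r}.
Arguments join {r}.
Arguments rk {r}.
Arguments meetl {r}.
Arguments meetr {r}.
Arguments joinl {r}.
Arguments joinr {r}.
Arguments lle_refl {r}.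
Arguments rk_modular {r}.
Arguments rk_max {r}.

#[local] Obligation Tactic := idtac.

Program Definition dual (L : ranked_lattice) : ranked_lattice :=
  @RankedLattice L (fun x y => lle y x) join meet
    (fun x => rk_bound L - rk x) (rk_bound L) _ _ _ _ _ _ _ _ _ _ _ _.
Next Obligation. by move=> L x; exact: lle_refl. Qed.
Next Obligation. by move=> L y x z yx zy; exact: lle_trans zy yx. Qed.
Next Obligation. by move=> L x y; exact: joinl. Qed.
Next Obligation. by move=> L x y; exact: joinr. Qed.
Next Obligation. by move=> L x y z; exact: join_lub. Qed.
Next Obligation. by move=> L x y; exact: meetl. Qed.
Next Obligation. by move=> L x y; exact: meetr. Qed.
Next Obligation. by move=> L x y z; exact: meet_glb. Qed.
Next Obligation. by move=> L x y /rk_le; lia. Qed.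
Next Obligation.
move=> L x y yx le_xy; apply/esym/rk_eq => //.
by have := rk_max x; have := rk_max y; lia.
Qed.
Next Obligation.
move=> L x y; have := rk_modular x y.
have := rk_max x; have := rk_max y; have := rk_max (join x y).
by have := rk_max (meet x y); lia.
Qed.
Next Obligation. by move=> L x; lia. Qed.

Section LatticeTheory.
Variable L : ranked_lattice.
Implicit Types S T U : L.

Lemma lle_anti S T : lle S T -> lle T S -> S = T.
Proof. by move=> ST /rk_le TS; exact: rk_eq. Qed.

(* In a Grassmann graph the hypothesis says that T lies on a geodesic from S
   to U. *)
Lemma geodesic_meet S T U :
  rk T + rk (meet S U) <= rk (meet S T) + rk (meet T U) -> lle (meet S U) T.
Proof.
move=> h; set z := meet (meet S T) (meet T U).
have zT : lle z T := lle_trans (meetl _ _) (meetr _ _).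
have zSU : lle z (meet S U).
  by apply: meet_glb; [apply: lle_trans (meetl _ _) (meetl _ _)
                      |apply: lle_trans (meetr _ _) (meetr _ _)].
have /rk_le jT : lle (join (meet S T) (meet T U)) T.
  by apply: join_lub; [exact: meetr | exact: meetl].
have := rk_modular (meet S T) (meet T U); rewrite -/z => e.
by rewrite -(rk_eq zSU) //; lia.
Qed.

Definition adjacent r S T : Prop := (rk (meet S T)).+1 = r.

Lemma meetC S T : meet S T = meet T S.
Proof.
by apply: lle_anti; apply: meet_glb; [exact: meetr|exact: meetl|exact: meetr|exact: meetl].
Qed.

(** The meets of [S3] with [S1] and [S2] are hyperplanes of [S3]. If they differ they span [S3],
    which then lies below the join; if they coincide they equal the meet of [S1] and [S2]. *)
Lemma triangle_star_or_top r S1 S2 S3 : rk S1 = r -> rk S2 = r -> rk S3 = r ->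
  adjacent r S1 S3 -> adjacent r S2 S3 -> adjacent r S1 S2 ->
  lle (meet S1 S2) S3 \/ lle S3 (join S1 S2).
Proof.
rewrite /adjacent => r1 r2 r3 a13 a23 a12.
have [e|ne] := pselect (meet S1 S3 = meet S2 S3).
  left; suff -> : meet S1 S2 = meet S1 S3 by exact: meetr.
  apply/esym/rk_eq; last by lia.
  by apply: meet_glb; [exact: meetl | rewrite e; exact: meetl].
right; set j := join (meet S1 S3) (meet S2 S3).
have jS3 : lle j S3 by apply: join_lub; exact: meetr.
suff <- : j = S3.
  by apply: join_lub; [apply: lle_trans (meetl _ _) (joinl _ _)
                      |apply: lle_trans (meetl _ _) (joinr _ _)].
apply: rk_eq => //; rewrite leqNgt; apply/negP => lt_j.
apply: ne; transitivity j.
  by apply: rk_eq; [exact: joinl | lia].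
by apply/esym/rk_eq; [exact: joinr | lia].
Qed.

(** If [S4] were not below the join t, its meets with [S1], [S2] and [S3] would all equal
    [meet S4 t] by rank. This would also be the meet of [S1] and [S2], forcing that meet below
    [S3]. *)
Lemma clique_top r S1 S2 S3 S4 : rk S1 = r -> rk S2 = r -> rk S3 = r -> rk S4 = r ->
  adjacent r S1 S2 -> adjacent r S4 S1 -> adjacent r S4 S2 -> adjacent r S4 S3 ->
  lle S3 (join S1 S2) -> ~ lle (meet S1 S2) S3 -> lle S4 (join S1 S2).
Proof.
rewrite /adjacent => r1 r2 r3 r4 a12 a41 a42 a43 S3t nS3.
apply: contrapT => nS4; apply: nS3.
set t := join S1 S2 in S3t nS4.
have lt_t : rk (meet S4 t) < r.
  rewrite ltnNge; apply/negP => le_t; apply: nS4.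
  by rewrite -(rk_eq (meetl S4 t)) ?r4 //; exact: meetr.
have e S : lle S t -> (rk (meet S4 S)).+1 = r -> meet S4 S = meet S4 t.
  move=> St a; apply: rk_eq; last by lia.
  by apply: meet_glb; [exact: meetl | exact: lle_trans (meetr _ _) St].
have e1 := e _ (joinl _ _) a41; have e2 := e _ (joinr _ _) a42.
have e3 := e _ S3t a43.
suff <- : meet S4 t = meet S1 S2 by rewrite -e3; exact: meetr.
apply: rk_eq; last by rewrite -e1; lia.
by apply: meet_glb; [rewrite -e1|rewrite -e2]; exact: meetr.
Qed.

End LatticeTheory.

Lemma subset_between (n m : nat) (K B : {set 'I_n}) :
  K \subset B -> #|K| <= m <= #|B| ->
  exists I : {set 'I_n}, [/\ K \subset I, I \subset B & #|I| = m].
Proof.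
move=> KB /andP[Km mB].
have sz : m - #|K| <= size (enum (B :\: K)) by rewrite -cardE cardsD (setIidPr KB); lia.
set s := take (m - #|K|) (enum (B :\: K)).
have sE : #|[set x in s]| = m - #|K|.
  by rewrite cardsE (card_uniqP _) ?size_takel // take_uniq ?enum_uniq.
have sBK : [set x in s] \subset B :\: K.
  by apply/subsetP => x; rewrite inE => /mem_take; rewrite mem_enum.
exists (K :|: [set x in s]); split.
- exact: subsetUl.
- by rewrite subUset KB (subset_trans sBK) ?subsetDl.
- rewrite cardsU sE (_ : K :&: _ = set0) ?cards0; first by lia.
  apply/eqP; rewrite -subset0; apply/subsetP => x /setIP[xK /(subsetP sBK)].
  by rewrite inE xK.
Qed.

(* lia compares atoms syntactically, whereas cardinals of the same set may carry
   different but convertible spellings of the type of its elements. *)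
Ltac card_lia :=
  intros; repeat match goal with
    | H : is_true (leq _ _) |- _ => revert H
    | H : @eq nat _ _ |- _ => revert H end;
  clear; rewrite /reverse_coercion /=; lia.

Section Johnson.
Variables (n m : nat).
Implicit Types (I J K M : {set 'I_n}).

Section Iso.
Variable L : ranked_lattice.
Implicit Types (g h : {set 'I_n} -> L) (r : nat).

(* [g] represents an isometric embedding of J(n,m) in the Grassmann graph of
   rank r elements of L; its values on sets of other cardinalities are junk. *)
Definition isoJ r g := forall I J, #|I| = m -> #|J| = m ->
  rk (g I) = r /\ rk (meet (g I) (g J)) + m = r + #|I :&: J|.

(** Every clique of m-sets above a fixed (m-1)-set goes into a star. Top type is the same predicate
    taken in [dual L]. *)
Definition star_type g := forall I1 I2 I, #|I1| = m -> #|I2| = m -> #|I| = m ->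
  #|I1 :&: I2|.+1 = m -> I1 :&: I2 \subset I -> lle (meet (g I1) (g I2)) (g I).

Definition image_of g : set L := fun x => exists2 I : {set 'I_n}, #|I| = m & g I = x.

Lemma isoJ_rk r g I : isoJ r g -> #|I| = m -> rk (g I) = r.
Proof. by move=> iso cI; have [] := iso I I cI cI. Qed.

Lemma isoJ_meet r g I J : isoJ r g -> #|I| = m -> #|J| = m ->
  rk (meet (g I) (g J)) + m = r + #|I :&: J|.
Proof. by move=> iso cI cJ; have [] := iso I J cI cJ. Qed.

Lemma isoJ_join r g I J : isoJ r g -> #|I| = m -> #|J| = m ->
  rk (join (g I) (g J)) + #|I :&: J| = r + m.
Proof.
move=> iso cI cJ; have := rk_modular (g I) (g J).
by rewrite !(isoJ_rk iso) //; have := isoJ_meet iso cI cJ; lia.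
Qed.

Lemma isoJ_inj r g I J : isoJ r g -> #|I| = m -> #|J| = m -> g I = g J -> I = J.
Proof.
move=> iso cI cJ e; apply/eqP; rewrite eqEcard cJ cI leqnn andbT.
have := isoJ_meet iso cI cJ; have := isoJ_meet iso cI cI; rewrite setIid -e cI.
move=> -> /eqP; rewrite eqn_add2l => /eqP eI.
by apply/setIidPl/eqP; rewrite eqEcard subsetIl cI eI leqnn.
Qed.

End Iso.

Lemma isoJ_dual (L : ranked_lattice) r (g : {set 'I_n} -> L) :
  isoJ r g -> @isoJ (dual L) (rk_bound L - r) g.
Proof.
move=> iso I J cI cJ /=; split; first by rewrite (isoJ_rk iso).
have := isoJ_join iso cI cJ; have := rk_max (join (g I) (g J)).
by have := subset_leq_card (subsetIl I J); rewrite cI; card_lia.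
Qed.

End Johnson.

(** * Embeddings of star type *)

Section StarType.
Variables (n m : nat) (L : ranked_lattice) (r : nat) (g : {set 'I_n} -> L).
Implicit Types (I J K M W : {set 'I_n}).
Hypotheses (m_gt0 : 0 < m) (le_m_n : m + m <= n).
Hypotheses (iso : isoJ m r g) (star : star_type m g).

(** Induction on the number of elements of I outside I1 and I2. If there are none, I lies on a
    geodesic from I1 to I2. Otherwise such an element y is traded for each of two elements of the
    union; the two sets obtained meet in I minus y, so star type applies to them. *)
Lemma star_meet_le I1 I2 I : #|I1| = m -> #|I2| = m -> #|I| = m ->
  I1 :&: I2 \subset I -> lle (meet (g I1) (g I2)) (g I).
Proof.
move=> c1 c2; move: {2}#|_| (leqnn #|I :\: (I1 :|: I2)|) => d.
elim: d I => [|d IH] I le_d cI KI.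
  have IU : I \subset I1 :|: I2.
    by rewrite -setD_eq0 -cards_eq0 -leqn0.
  apply: geodesic_meet; rewrite (isoJ_rk iso cI).
  have := isoJ_meet iso c1 c2; have := isoJ_meet iso c1 cI.
  have := isoJ_meet iso cI c2.
  have := cardsUI (I1 :&: I) (I :&: I2).
  have -> : (I1 :&: I) :|: (I :&: I2) = I.
    by rewrite [I1 :&: I]setIC -setIUr; exact/setIidPl.
  have -> : (I1 :&: I) :&: (I :&: I2) = I1 :&: I2.
    by apply/setP => t; have := subsetP KI t; rewrite !inE; do 3!case: (t \in _) => //=; move/(_ isT).
  lia.
have [IU|] := boolP (I \subset I1 :|: I2).
  by apply: IH => //; move: IU; rewrite -setD_eq0 => /eqP->; rewrite cards0.
case/subsetPn => y yI yU.
have ltK : #|I1 :&: I2| < m.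
  rewrite ltnNge; apply/negP => le_K; case/negP: yU.
  have e1 : I1 :&: I2 = I1 by apply/eqP; rewrite eqEcard subsetIl c1.
  have e2 : I1 :&: I2 = I by apply/eqP; rewrite eqEcard KI cI.
  by rewrite inE -e1 e2 yI.
(* The union has at least m + 1 elements, and I contains at most m - 1 of them because y is not
   one. *)
have cV : 1 < #|(I1 :|: I2) :\: I|.
  have := cardsUI I1 I2; have := cardsID I (I1 :|: I2).
  have : (I1 :|: I2) :&: I \subset I :\ y.
    by rewrite subsetD1 subsetIr inE (negPf yU).
  move=> /subset_leq_card.
  by have := cardsD1 y I; rewrite yI add1n; lia.
have cy := cardsD1 y I; rewrite yI add1n in cy.
have hx z : z \in (I1 :|: I2) :\: I ->
    #|z |: I :\ y| = m /\ lle (meet (g I1) (g I2)) (g (z |: I :\ y)).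
  move=> /setDP[zU zI].
  have cJ : #|z |: I :\ y| = m.
    by rewrite cardsU1 !inE (negPf zI) andbF add1n -cy.
  split => //; apply: IH => //; last first.
    apply/subsetP => t tK; rewrite !inE (subsetP KI _ tK) andbT.
    apply/orP; right; apply: contraNneq yU => <-.
    by move: tK; rewrite !inE => /andP[->].
  rewrite -ltnS; apply: leq_trans le_d; apply: proper_card.
  apply/properP; split.
    apply/subsetP => t /setDP[tz tU]; rewrite inE tU /=.
    by move: tz tU; rewrite !inE => /orP[/eqP->|/andP[_ ->//]]; rewrite -in_setU zU.
  exists y; first by rewrite !inE yI -in_setU yU.
  rewrite !inE eqxx /= orbF; apply/nandP; right.
  by apply: contra zI => /eqP <-.
have /card_gt1P[x [x' [xV xV' neq_x]]] := cV.
have [cJ lJ] := hx x xV; have [cJ' lJ'] := hx x' xV'.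
have eJ : (x |: I :\ y) :&: (x' |: I :\ y) = I :\ y.
  apply/setP => t; rewrite !inE; case: (eqVneq t x) => [->|_]; rewrite ?eqxx ?(negPf neq_x) //=.
  by case: (t \in I); rewrite ?andbF ?andbT //; case: (t != y); rewrite ?orbT ?andbF.
apply: lle_trans (meet_glb lJ lJ') _; apply: star => //; rewrite eJ; first by lia.
exact: subsetDl.
Qed.

Lemma exists_avoiding K W : [disjoint K & W] -> #|K| <= m -> #|W| <= m ->
  exists I, [/\ K \subset I, [disjoint I & W] & #|I| = m].
Proof.
move=> KW cK cW; have [||I [KI IW cI]] := @subset_between n m K (~: W).
- by rewrite -disjoints_subset.
- by have := cardsC W; rewrite card_ord cK; lia.
by exists I; rewrite disjoints_subset.
Qed.

(** Since 2m <= n, K can be completed to two m-sets that are disjoint outside K. *)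
Lemma exists_meet_generators K : #|K| <= m ->
  exists I1 I2, [/\ #|I1| = m, #|I2| = m & I1 :&: I2 = K].
Proof.
move=> cK; have [|||I1 [KI1 _ c1]] := @exists_avoiding K set0 => //.
- by rewrite disjoints_subset setC0 subsetT.
- by rewrite cards0.
have [|||I2 [KI2 dI c2]] := @exists_avoiding K (I1 :\: K) => //.
- by rewrite disjoints_subset; apply/subsetP => t tK; rewrite !inE tK.
- by rewrite -c1 subset_leq_card ?subsetDl.
exists I1, I2; split => //; apply/eqP; rewrite eqEsubset subsetI KI1 KI2 !andbT.
apply/subsetP => t /setIP[t1 t2]; move/pred0P: dI => /(_ t) /=.
by rewrite t2 inE t1 /= andbT => /negbFE.
Qed.

Lemma star_core_exists : exists p : {set 'I_n} -> L, forall K, #|K| <= m ->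
  exists I1 I2, [/\ #|I1| = m, #|I2| = m, I1 :&: I2 = K & p K = meet (g I1) (g I2)].
Proof.
have /choice[p hp] : forall K, exists x : L, #|K| <= m ->
    exists I1 I2, [/\ #|I1| = m, #|I2| = m, I1 :&: I2 = K & x = meet (g I1) (g I2)].
  move=> K; have [cK|] := leqP #|K| m; last by exists (g set0).
  have [I1 [I2 [c1 c2 e]]] := exists_meet_generators cK.
  by exists (meet (g I1) (g I2)) => _; exists I1, I2.
by exists p.
Qed.

(* The meet of all [g I] with [K \subset I], see [core_le] and [core_glb]. *)
Definition core := sval (cid star_core_exists).

Lemma coreE K : #|K| <= m ->
  exists I1 I2, [/\ #|I1| = m, #|I2| = m, I1 :&: I2 = K & core K = meet (g I1) (g I2)].
Proof. exact: (svalP (cid star_core_exists)). Qed.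

Lemma core_rk K : #|K| <= m -> rk (core K) + m = r + #|K|.
Proof.
by move=> /coreE[I1 [I2 [c1 c2 <- ->]]]; exact: isoJ_meet.
Qed.

Lemma core_le K I : #|I| = m -> K \subset I -> lle (core K) (g I).
Proof.
move=> cI KI; have /coreE[I1 [I2 [c1 c2 e ->]]] : #|K| <= m.
  by rewrite -cI subset_leq_card.
by apply: star_meet_le; rewrite ?e.
Qed.

Lemma core_glb K x : #|K| <= m ->
  (forall I, #|I| = m -> K \subset I -> lle x (g I)) -> lle x (core K).
Proof.
move=> /coreE[I1 [I2 [c1 c2 <- ->]]] h.
by apply: meet_glb; apply: h; rewrite // ?subsetIl ?subsetIr.
Qed.

Lemma core_mono K K' : #|K'| <= m -> K \subset K' -> lle (core K) (core K').
Proof.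
move=> cK' KK'; apply: core_glb => // I cI K'I.
by apply: core_le => //; exact: subset_trans K'I.
Qed.

(** K extends to an m-set I' that avoids the rest of I; then I' and I meet in K :&: I, and
    [star_meet_le] applies to them. *)
Lemma core_meet K I : #|K| <= m -> #|I| = m -> meet (core K) (g I) = core (K :&: I).
Proof.
move=> cK cI; have cKI : #|K :&: I| <= m by rewrite (leq_trans _ cK) ?subset_leq_card ?subsetIl.
apply: lle_anti; last first.
  by apply: meet_glb; [apply: core_mono; rewrite ?subsetIl | apply: core_le; rewrite ?subsetIr].
have [|||I' [KI' dI c']] := @exists_avoiding K (I :\: K) => //.
- by rewrite disjoints_subset; apply/subsetP => t tK; rewrite !inE tK.
- by rewrite -cI subset_leq_card ?subsetDl.
apply: core_glb => // J cJ KJ.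
apply: (@lle_trans _ (meet (g I') (g I))).
  by apply: meet_glb; [apply: lle_trans (meetl _ _) (core_le c' KI') | exact: meetr].
apply: star_meet_le => //; apply: subset_trans KJ; rewrite subsetI subsetIr andbT.
apply/subsetP => t /setIP[t1 t2]; move/pred0P: dI => /(_ t) /=.
by rewrite t1 inE t2 /= andbT => /negbFE.
Qed.

Lemma core_full I : #|I| = m -> core I = g I.
Proof.
move=> cI; apply: rk_eq; first exact: core_le.
by have := @core_rk I; rewrite (isoJ_rk iso cI) cI; lia.
Qed.

Lemma core_le_subset K I : #|K| <= m -> #|I| = m -> lle (core K) (g I) -> K \subset I.
Proof.
move=> cK cI le_KI; apply/setIidPl/eqP; rewrite eqEcard subsetIl /=.
have /rk_le : lle (core K) (core (K :&: I)).
  by rewrite -core_meet //; apply: meet_glb => //; exact: lle_refl.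
have cKI : #|K :&: I| <= m by rewrite (leq_trans _ cK) ?subset_leq_card ?subsetIl.
have := core_rk cK; have := core_rk cKI. card_lia.
Qed.

(** The elements [core [set i]] act as independent points over [core set0]: by modularity and
    [core_rk], the core of K is the join of the core of K minus i and the point of i. *)
Lemma core1_generate I (T : L) : #|I| = m ->
  (forall i, i \in I -> lle (core [set i]) T) -> lle (g I) T.
Proof.
move=> cI; rewrite -core_full // => hT.
have : forall d K, #|K| = d.+1 -> K \subset I -> lle (core K) T; last first.
  by apply; [rewrite cI; exact/esym/(prednK m_gt0) | exact: subxx].
elim => [|d IH] K cK KI.
  have /cards1P[i eK] : #|K| == 1 by rewrite cK.
  by rewrite eK; apply: hT; apply: (subsetP KI); rewrite eK set11.
have [i iK] : exists i, i \in K by apply/card_gt0P; rewrite cK.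
have cK' : #|K :\ i| = d.+1 by have := cardsD1 i K; rewrite iK cK add1n; lia.
have le_d : d.+2 <= m by rewrite -cK -cI subset_leq_card.
have cm : #|K| <= m by rewrite cK.
have c1 : #|[set i]| <= m by rewrite cards1.
have cm' : #|K :\ i| <= m by rewrite cK'; lia.
have leJ : lle (join (core (K :\ i)) (core [set i])) (core K).
  by apply: join_lub; apply: core_mono; rewrite ?subsetDl ?sub1set.
have leM : lle (meet (core (K :\ i)) (core [set i])) (core set0).
  have [|||J [KJ dJ cJ]] := @exists_avoiding (K :\ i) [set i] => //.
    by rewrite disjoints_subset; apply/subsetP => t; rewrite !inE => /andP[].
  have -> : set0 = [set i] :&: J.
    apply/esym/eqP; rewrite -subset0; apply/subsetP => t /setIP[ti tJ].
    by move/pred0P: dJ => /(_ t) /=; rewrite tJ ti.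
  rewrite -core_meet //; apply: meet_glb; first exact: meetr.
  by apply: lle_trans (meetl _ _) (core_le cJ KJ).
have <- : join (core (K :\ i)) (core [set i]) = core K.
  apply: rk_eq => //; have := rk_modular (core (K :\ i)) (core [set i]).
  have := rk_le leM; have := core_rk cm; have := core_rk cm'; have := core_rk c1.
  by have := @core_rk set0; rewrite cards0 cards1 cK cK' => /(_ isT); lia.
apply: join_lub.
  by apply: IH => //; exact: subset_trans (subsetDl _ _) KI.
by apply: hT; exact: (subsetP KI).
Qed.

(** The accumulated meet stands on the left so that each step of the fold is an instance of
    [core_meet]. *)
Definition big_meet I0 (s : seq {set 'I_n}) := foldr (fun I x => meet x (g I)) (g I0) s.

Lemma big_meet_core I0 s : #|I0| = m -> (forall I, I \in s -> #|I| = m) ->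
  big_meet I0 s = core (foldr (fun I K => K :&: I) I0 s).
Proof.
move=> c0; elim: s => [|I s IH] hs /=; first by rewrite core_full.
have hs' J : J \in s -> #|J| = m by move=> Js; apply: hs; rewrite inE Js orbT.
rewrite IH // core_meet // ?(hs I) ?mem_head //.
suff /subset_leq_card : foldr (fun I K : {set 'I_n} => K :&: I) I0 s \subset I0 by rewrite c0.
by elim: s {IH hs hs'} => //= J s IH; exact: subset_trans (subsetIl _ _) IH.
Qed.

End StarType.

(** * Star type or top type *)

Section TypeDichotomy.
Variables (n m : nat) (L : ranked_lattice) (r : nat) (g : {set 'I_n} -> L).
Implicit Types (I J K M : {set 'I_n}) (x y z : 'I_n).

Lemma subset_succ M I : M \subset I -> #|M|.+1 = #|I| -> exists2 y, y \notin M & I = y |: M.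
Proof.
move=> MI cI; have : #|I :\: M| == 1.
  by rewrite cardsD (setIidPr MI) -cI subSnn.
case/cards1P => y eI; exists y.
  have : y \in I :\: M by rewrite eI set11.
  by case/setDP.
by rewrite -{1}(setID I M) (setIidPr MI) eI setUC.
Qed.

Lemma setU1I M x y : x != y -> (x |: M) :&: (y |: M) = M.
Proof.
move=> neq; apply/setP => t; rewrite !inE; case: (eqVneq t x) => [->|_] /=.
  by rewrite (negPf neq).
by case: (t \in M); rewrite ?orbT ?andbF.
Qed.

(** The pencil of M is the clique of m-sets containing the (m-1)-set M, indexed by the added
    element. *)
Definition pencil_star M := forall y1 y2 y3,
  y1 \notin M -> y2 \notin M -> y3 \notin M -> y1 != y2 ->
  lle (meet (g (y1 |: M)) (g (y2 |: M))) (g (y3 |: M)).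

Definition pencil_top M := forall y1 y2 y3,
  y1 \notin M -> y2 \notin M -> y3 \notin M -> y1 != y2 ->
  lle (g (y3 |: M)) (join (g (y1 |: M)) (g (y2 |: M))).

Hypotheses (m_gt1 : 1 < m) (lt_m_n : m + 2 <= n) (iso : isoJ m r g).

Lemma card_add M y : #|M|.+1 = m -> y \notin M -> #|y |: M| = m.
Proof. by move=> <- yM; rewrite cardsU1 yM. Qed.

Lemma pencil_adjacent M y1 y2 : #|M|.+1 = m -> y1 \notin M -> y2 \notin M ->
  y1 != y2 -> adjacent r (g (y1 |: M)) (g (y2 |: M)).
Proof.
move=> cM y1M y2M neq; rewrite /adjacent.
have := isoJ_meet iso (card_add cM y1M) (card_add cM y2M).
by rewrite setU1I //; card_lia.
Qed.

(** If the pencil is no star, some three members violate the star condition and thus lie below a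
    common join t. All other members are adjacent to these three, so [clique_top] puts them below t,
    and any two members have join t by rank. *)
Lemma pencil_dichotomy M : #|M|.+1 = m -> pencil_star M \/ pencil_top M.
Proof.
move=> cM; have rkg y : y \notin M -> rk (g (y |: M)) = r.
  by move=> yM; apply: isoJ_rk iso _; exact: card_add.
have adj := pencil_adjacent cM.
have [|nS] := pselect (pencil_star M); [by left | right].
have [y1 [y2 [y3 [y1M y2M y3M neq nle]]]] : exists y1 y2 y3,
    [/\ y1 \notin M, y2 \notin M, y3 \notin M, y1 != y2 &
        ~ lle (meet (g (y1 |: M)) (g (y2 |: M))) (g (y3 |: M))].
  apply: contrapT => h; apply: nS => y1 y2 y3 y1M y2M y3M neq.
  by apply: contrapT => nle; apply: h; exists y1, y2, y3.
set t := join (g (y1 |: M)) (g (y2 |: M)).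
have neq13 : y1 != y3 by apply/eqP => e; apply: nle; rewrite e; exact: meetl.
have neq23 : y2 != y3 by apply/eqP => e; apply: nle; rewrite e; exact: meetr.
have t3 : lle (g (y3 |: M)) t.
  by have [] := triangle_star_or_top (rkg _ y1M) (rkg _ y2M) (rkg _ y3M)
    (adj _ _ y1M y3M neq13) (adj _ _ y2M y3M neq23) (adj _ _ y1M y2M neq).
have all_t y : y \notin M -> lle (g (y |: M)) t.
  move=> yM.
  have [->|n1] := eqVneq y y1; first exact: joinl.
  have [->|n2] := eqVneq y y2; first exact: joinr.
  have [->|n3] := eqVneq y y3; first exact: t3.
  exact: (clique_top (rkg _ y1M) (rkg _ y2M) (rkg _ y3M) (rkg _ yM)
    (adj _ _ y1M y2M neq) (adj _ _ yM y1M n1) (adj _ _ yM y2M n2) (adj _ _ yM y3M n3)).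
move=> z1 z2 z3 z1M z2M z3M neqz.
have -> : join (g (z1 |: M)) (g (z2 |: M)) = t; last exact: all_t.
apply: rk_eq; first by apply: join_lub; exact: all_t.
have := isoJ_join iso (card_add cM z1M) (card_add cM z2M).
have := isoJ_join iso (card_add cM y1M) (card_add cM y2M).
by rewrite !setU1I // /t; card_lia.
Qed.

(** Two pencils sharing the vertex N cannot have opposite types. The sets [A y], [B y] and N form a
    triangle, where y and z lie outside N, and [A] and [B] run through the two pencils. *)
Lemma pencil_star_top_excl K x x' : #|K|.+2 = m -> x \notin K -> x' \notin K ->
  x != x' -> pencil_star (x |: K) -> pencil_top (x' |: K) -> False.
Proof.
move=> cK xK x'K neq hs ht.
have cxK : #|x |: K|.+1 = m by rewrite cardsU1 xK.
have cx'K : #|x' |: K|.+1 = m by rewrite cardsU1 x'K.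
set N := x' |: (x |: K).
have x'xK : x' \notin x |: K by rewrite !inE negb_or x'K andbT eq_sym.
have xx'K : x \notin x' |: K by rewrite !inE negb_or xK andbT.
have eN : N = x |: (x' |: K) by rewrite /N setUCA.
have cN : #|N| = m by exact: card_add.
have : 1 < #|~: N| by have := cardsC N; rewrite card_ord cN; card_lia.
case/card_gt1P => y [z [yN zN neqyz]].
have nin t : t \in ~: N -> [/\ t \notin x |: K, t \notin x' |: K, t \notin K, t != x & t != x'].
  by rewrite !inE !negb_or => /and3P[-> -> ->].
have [yx yx' yK ynx ynx'] := nin _ yN; have [zx zx' zK znx znx'] := nin _ zN.
pose A t := t |: (x |: K); pose B t := t |: (x' |: K).
have cA t : t \in ~: N -> #|A t| = m by move=> /nin[*]; exact: card_add.
have cB t : t \in ~: N -> #|B t| = m by move=> /nin[*]; exact: card_add.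
have rkg I : #|I| = m -> rk (g I) = r by exact: isoJ_rk iso.
have cAB s t : s \in ~: N -> t \in ~: N -> s != t -> #|A s :&: B t|.+2 = m.
  move=> /nin[sx sx' sK snx snx'] /nin[tx tx' tK tnx tnx'] st.
  suff -> : A s :&: B t = K by [].
  apply/setP => u; rewrite !inE.
  case: (eqVneq u s) => [->|_] /=; first by rewrite (negPf st) (negPf snx') /=.
  case: (eqVneq u x) => [->|_] /=; last by case: (u \in K); rewrite ?orbT ?andbF.
  by rewrite (negPf neq) /= eq_sym (negPf tnx).
have aAN : adjacent r (g (A y)) (g N) by apply: pencil_adjacent.
have aBN : adjacent r (g (B y)) (g N) by rewrite eN; apply: pencil_adjacent.
have aBA : adjacent r (g (B y)) (g (A y)).
  rewrite /B /A !(setUCA [set y]); apply: pencil_adjacent; rewrite ?[x' == x]eq_sym //.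
  - by rewrite cardsU1 yK.
  - by rewrite !inE negb_or x'K andbT eq_sym.
  - by rewrite !inE negb_or xK andbT eq_sym.
have aNA : adjacent r (g N) (g (A y)) by rewrite /adjacent meetC.
(* If the triangle is a star, its common meet lies below [A z] too, so [A z] and [B y] become
   adjacent. If it is a top, its common join contains [B z], so [A y] and [B z] become adjacent.
   Both pairs of index sets share only m - 2 elements. *)
have [le_w|le_t] := triangle_star_or_top (rkg _ (cB _ yN)) (rkg _ cN) (rkg _ (cA _ yN)) aBA aNA aBN.
  have e : meet (g (B y)) (g N) = meet (g (A y)) (g N).
    apply: rk_eq; first by apply: meet_glb => //; exact: meetr.
    by move: aAN aBN; rewrite /adjacent => <- /succn_inj->.
  have le_z : lle (meet (g (A y)) (g N)) (g (A z)) by apply: hs.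
  have /rk_le : lle (meet (g (A y)) (g N)) (meet (g (A z)) (g (B y))).
    by apply: meet_glb => //; rewrite -e; exact: meetl.
  have neqzy : z != y by rewrite eq_sym.
  have := isoJ_meet iso (cA _ zN) (cB _ yN); have := cAB _ _ zN yN neqzy.
  by move: aAN; rewrite /adjacent; card_lia.
have le_z : lle (g (B z)) (join (g (B y)) (g N)) by rewrite eN; apply: ht.
have /rk_le := join_lub le_t le_z.
have := isoJ_join iso (cA _ yN) (cB _ zN); have := cAB _ _ yN zN neqyz.
have := rk_modular (g (B y)) (g N); rewrite !rkg ?cB //.
by move: aBN; rewrite /adjacent; card_lia.
Qed.

(** M is carried to M' by exchanging one element at a time; consecutive pencils share a vertex and
    so have the same type. *)
Lemma pencil_top_connected M M' : #|M|.+1 = m -> #|M'|.+1 = m ->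
  pencil_top M -> pencil_top M'.
Proof.
move=> cM cM'; move: {2}#|_| (leqnn #|M' :\: M|) => d.
elim: d M cM => [|d IH] M cM le_d topM.
  suff <- : M = M' by [].
  apply/esym/eqP; rewrite eqEcard -setD_eq0 -cards_eq0 -leqn0 le_d /=.
  by rewrite -ltnS cM cM'.
have [MM'|] := boolP (M' \subset M).
  by apply: (IH M) => //; move: MM'; rewrite -setD_eq0 => /eqP->; rewrite cards0.
case/subsetPn => b bM' bM.
have : ~~ (M \subset M').
  apply/negP => MM'; have /eqP e : M == M' by rewrite eqEcard MM'; card_lia.
  by rewrite e bM' in bM.
case/subsetPn => a aM aM'.
have aK : a \notin M :\ a by rewrite !inE eqxx.
have bK : b \notin M :\ a by rewrite !inE (negPf bM) andbF.
have neq : b != a by apply: contraNneq bM => ->.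
have cK : #|M :\ a|.+2 = m by have := cardsD1 a M; rewrite aM add1n; card_lia.
apply: (IH (b |: M :\ a)).
- by rewrite cardsU1 bK.
- rewrite -ltnS; apply: leq_trans le_d; apply: proper_card; apply/properP; split.
    apply/subsetP => t; rewrite !inE negb_or negb_and negbK.
    move=> /andP[/andP[_ /orP[/eqP->|->//]] aM'2]; by rewrite aM'2 in aM'.
  by exists b; rewrite !inE ?eqxx // bM.
have [] := @pencil_dichotomy (b |: M :\ a) => //.
  by rewrite cardsU1 bK.
move=> hs; exfalso; apply: (pencil_star_top_excl cK bK aK neq hs).
by rewrite setD1K.
Qed.

Lemma star_type_dichotomy : star_type m g \/ @star_type n m (dual L) g.
Proof.
have cI0 M I : #|I| = m -> M \subset I -> #|M|.+1 = m ->
    exists2 y, y \notin M & I = y |: M.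
  by move=> cI MI cM; apply: subset_succ => //; rewrite cM cI.
have [all_s|] := pselect (forall M, #|M|.+1 = m -> pencil_star M).
  left=> I1 I2 I c1 c2 cI cM sI; have hs := all_s _ cM.
  set M := I1 :&: I2 in cM sI hs *.
  have [y1 y1M e1] := cI0 _ _ c1 (subsetIl I1 I2 : M \subset I1) cM.
  have [y2 y2M e2] := cI0 _ _ c2 (subsetIr I1 I2 : M \subset I2) cM.
  have [y yM e] := cI0 _ _ cI sI cM.
  rewrite e e1 e2; apply: hs => //; apply/eqP => ey.
  by move: cM; rewrite /M e1 ey -e2 setIid c2; card_lia.
move=> /existsNP[M0 /not_implyP[cM0 nS]]; right.
have top0 : pencil_top M0 by have [] := pencil_dichotomy cM0.
move=> I1 I2 I c1 c2 cI cM sI; have hs := pencil_top_connected cM0 cM top0.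
set M := I1 :&: I2 in cM sI hs *.
have [y1 y1M e1] := cI0 _ _ c1 (subsetIl I1 I2 : M \subset I1) cM.
have [y2 y2M e2] := cI0 _ _ c2 (subsetIr I1 I2 : M \subset I2) cM.
have [y yM e] := cI0 _ _ cI sI cM.
rewrite e e1 e2; apply: hs => //; apply/eqP => ey.
by move: cM; rewrite /M e1 ey -e2 setIid c2; card_lia.
Qed.

End TypeDichotomy.

(** * Intersections of images *)

Lemma mem_foldr_setI (T : finType) (I0 : {set T}) (s : seq {set T}) x :
  (x \in foldr (fun I K => K :&: I) I0 s) = (x \in I0) && all (fun I : {set T} => x \in I) s.
Proof.
elim: s => [|I s IH] /=; first by rewrite andbT.
by rewrite inE IH -andbA; congr (_ && _); rewrite andbC.
Qed.

Section Exchange.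
Variables (n m : nat) (L : ranked_lattice) (r : nat) (g h : {set 'I_n} -> L).
Implicit Types (I J K M : {set 'I_n}) (x y z : 'I_n).
Hypotheses (m_gt0 : 0 < m) (le_m_n : m + m <= n).
Hypotheses (isog : isoJ m r g) (starg : star_type m g).
Hypotheses (isoh : isoJ m r h) (starh : star_type m h).

Let p := core g m_gt0 le_m_n.
Let q := core h m_gt0 le_m_n.

(** For each j != i choose a common member [g I = h J] with i in I and j not in I. The meet of these
    members is the core of {i} on the side of g; on the side of h it is the core of the intersection
    of the J, which is a singleton by rank. *)
Lemma core1_match i :
  (forall j, i != j -> exists I, [/\ #|I| = m, i \in I, j \notin I & image_of m h (g I)]) ->
  exists j, p [set i] = q [set j].
Proof.
move=> hij.
have /choice[c hc] : forall j, exists c : {set 'I_n} * {set 'I_n}, i != j ->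
    [/\ #|c.1| = m, i \in c.1, j \notin c.1, #|c.2| = m & h c.2 = g c.1].
  move=> j; have [<-|ij] := eqVneq i j; first by exists (set0, set0).
  by have [I [cI iI jI [J cJ e]]] := hij j ij; exists (I, J).
(* [j0] supplies the starting set of the two folds; it exists because n >= 2m >= 2. *)
have [j0 neq0] : exists j, i != j.
  have : 0 < #|~: [set i]| by rewrite cardsC1 card_ord; lia.
  by case/card_gt0P => j; rewrite !inE eq_sym; exists j.
pose js := enum (~: [set i]).
have jsP j : j \in js -> i != j by rewrite mem_enum !inE eq_sym.
pose s1 := [seq (c j).1 | j <- js]; pose s2 := [seq (c j).2 | j <- js].
have [c01 i01 _ c02 e0] := hc _ neq0.
have e : big_meet g (c j0).1 s1 = big_meet h (c j0).2 s2.
  rewrite /s1 /s2; move: (js) jsP; elim=> [|j l IH] /= lP; first by rewrite e0.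
  have [_ _ _ _ ej] := hc j (lP j (mem_head _ _)).
  by rewrite ej IH // => k kl; apply: lP; rewrite inE kl orbT.
rewrite (big_meet_core m_gt0 le_m_n isog starg) // in e; last first.
  by move=> I /mapP[j /jsP ij ->]; have [] := hc j ij.
rewrite (big_meet_core m_gt0 le_m_n isoh starh) // in e; last first.
  by move=> I /mapP[j /jsP ij ->]; have [] := hc j ij.
move: e; set K1 := foldr _ _ s1; set K2 := foldr _ _ s2 => e.
have e1 : K1 = [set i].
  apply/setP => t; rewrite mem_foldr_setI in_set1; case: (eqVneq t i) => [->|ti].
    by rewrite i01; apply/allP => I /mapP[j /jsP ij ->]; have [] := hc j ij.
  apply/negP => /andP[_ /allP h1]; rewrite eq_sym in ti.
  have [_ _ + _ _] := hc t ti; rewrite h1 //.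
  by apply: map_f; rewrite mem_enum !inE eq_sym.
have cK2 : #|K2| <= m.
  rewrite -c02; apply: subset_leq_card; apply/subsetP => t.
  by rewrite mem_foldr_setI => /andP[].
have : #|K2| == 1.
  have c1 : #|K1| <= m by rewrite e1 cards1.
  have := core_rk m_gt0 le_m_n isog c1; have := core_rk m_gt0 le_m_n isoh cK2.
  by rewrite e e1 cards1; card_lia.
by case/cards1P => j e2; exists j; rewrite /p /q -e1 -e2.
Qed.

(** The matching of points gives an injection s of indices. All points of [g I] lie below
    [h (s @: I)], and the two have the same rank. *)
Lemma star_images_sub :
  (forall i j, i != j -> exists I, [/\ #|I| = m, i \in I, j \notin I & image_of m h (g I)]) ->
  forall I, #|I| = m -> image_of m h (g I).
Proof.
move=> hij I cI.
have /choice[s hs] : forall i, exists j, p [set i] = q [set j].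
  by move=> i; apply: core1_match => j; exact: hij.
have c1 (i : 'I_n) : #|[set i]| <= m by rewrite cards1.
have sinj : injective s.
  move=> i j e; apply/eqP/negPn/negP => ij.
  have [J [cJ iJ jJ _]] := hij i j ij; case/negP: jJ.
  rewrite -sub1set; apply: (@core_le_subset _ _ _ _ _ m_gt0 le_m_n isog starg _ _ (c1 j) cJ).
  rewrite -/p hs -e -hs; apply: (@core_le _ _ _ _ _ m_gt0 le_m_n isog starg) => //.
  by rewrite sub1set.
exists (s @: I); first by rewrite card_imset.
have cs : #|s @: I| = m by rewrite card_imset.
apply/esym/rk_eq; last by rewrite (isoJ_rk isog) // (isoJ_rk isoh).
apply: (@core1_generate _ _ _ _ _ m_gt0 le_m_n isog starg _ _ cI) => i iI.
by rewrite -/p hs; apply: (@core_le _ _ _ _ _ m_gt0 le_m_n isoh starh) => //; rewrite sub1set imset_f.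
Qed.

Lemma star_exchange I0 : #|I0| = m -> ~ image_of m h (g I0) ->
  exists i j, i != j /\
    forall I, #|I| = m -> i \in I -> j \notin I -> ~ image_of m h (g I).
Proof.
move=> c0 n0; apply: contrapT => no; apply: n0; apply: star_images_sub => // i j ij.
apply: contrapT => no'; apply: no; exists i, j; split => // I cI iI jI hI.
by apply: no'; exists I.
Qed.

End Exchange.

(** Removing i is a bijection onto the m-subsets of the complement of {i, j}. *)
Lemma card_separating (n m : nat) (i j : 'I_n) : i != j ->
  #|[set I : {set 'I_n} | [&& #|I| == m.+1, i \in I & j \notin I]]| = 'C(n.-2, m).
Proof.
move=> ij.
have cB : #|~: [set i; j]| = n.-2.
  by have := cardsC [set i; j]; rewrite cards2 ij card_ord; card_lia.
rewrite -cB -cards_draws -(@card_in_imset _ _ (fun I => i |: I)); last first.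
  move=> A B; rewrite !inE => /andP[sA _] /andP[sB _] e.
  have ni (C : {set 'I_n}) : C \subset ~: [set i; j] -> (i |: C) :\ i = C.
    move=> sC; rewrite setU1K //; apply/negP => /(subsetP sC).
    by rewrite !inE eqxx.
  by rewrite -(ni A sA) e ni.
congr #|pred_of_set _|; apply/setP => I; rewrite !inE; apply/and3P/imsetP.
  move=> [/eqP cI iI jI]; exists (I :\ i); last by rewrite setD1K.
  rewrite !inE; apply/andP; split; last first.
    by have := cardsD1 i I; rewrite iI cI add1n => -[<-].
  apply/subsetP => t; rewrite !inE negb_or => /andP[-> tI] /=.
  by apply: contraNneq jI => <-.
move=> [A]; rewrite inE => /andP[sA /eqP cA] ->.
have iA : i \notin A by apply/negP => /(subsetP sA); rewrite !inE eqxx.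
have jA : j \notin A by apply/negP => /(subsetP sA); rewrite !inE eqxx orbT.
split; first by rewrite cardsU1 iA cA.
  by rewrite !inE eqxx.
by rewrite !inE negb_or jA eq_sym ij.
Qed.

Definition outside (n m : nat) (L : ranked_lattice) (g h : {set 'I_n} -> L) :=
  [set I : {set 'I_n} | (#|I| == m) && ~~ `[< image_of m h (g I) >]].

(** * Excluding images of different types when 2m < n *)

Section Mixed.
Variables (n m : nat) (L : ranked_lattice) (r : nat) (a b c : {set 'I_n} -> L).
Implicit Types (I J K M : {set 'I_n}) (x y z : 'I_n).
Hypotheses (m_gt1 : 1 < m) (lt_m_n : m + m < n).
Hypotheses (isoa : isoJ m r a) (isob : isoJ m r b) (isoc : isoJ m r c).
Hypothesis topa : @star_type n m (dual L) a.
Hypotheses (starb : star_type m b) (starc : star_type m c).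
Hypothesis sub_abc : forall I, #|I| = m -> image_of m b (a I) \/ image_of m c (a I).
Hypothesis small : #|outside m b c| <= 'C(n.-2, m.-1).

Lemma mixed_sub I : #|I| = m -> image_of m c (b I).
Proof.
have m_gt0 : 0 < m by lia.
have le_m_n : m + m <= n by lia.
pose p := core b m_gt0 le_m_n; pose p' := core c m_gt0 le_m_n.
pose q := @core n m (dual L) a m_gt0 le_m_n.
have isoa' := isoJ_dual isoa.
have c1 (i : 'I_n) : #|[set i]| <= m by rewrite cards1.
move=> cI; apply: contrapT => nI.
have [u [v [uv huv]]] := star_exchange m_gt0 le_m_n isob starb isoc starc cI nI.
(* The exchange pair already yields 'C(n - 2, m - 1) index sets outside c, and [small] allows no
   others. *)
have outE : outside m b c = [set J : {set 'I_n} | [&& #|J| == m, u \in J & v \notin J]].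
  apply/esym/eqP; rewrite eqEcard; apply/andP; split.
    apply/subsetP => J; rewrite !inE => /and3P[/eqP cJ uJ vJ].
    by rewrite cJ eqxx; apply/asboolPn; exact: huv.
  by move: small; rewrite -(card_separating m.-1 uv) (prednK m_gt0).
(* Such a member is some [b K] outside c, so K contains u by [outE]. *)
have above J : #|J| = m -> ~ image_of m c (a J) -> lle (p [set u]) (a J).
  move=> cJ nJ; have [[K cK e]|//] := sub_abc cJ.
  have : K \in outside m b c by rewrite inE cK eqxx /=; apply/asboolPn; rewrite e.
  rewrite outE inE -e => /and3P[_ uK _].
  by apply: (@core_le _ _ _ _ _ m_gt0 le_m_n isob starb) => //; rewrite sub1set.
(* In [dual L] the [q [set j]] are points, hence hyperplanes here, and each [a J] is the meet of
   those with j in J. If all contained p_u, it would lie below two members with disjoint index sets,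
   whose meet has rank r - m, one less than that of p_u. *)
have [j hj] : exists j, ~ lle (p [set u]) (q [set j]).
  apply: contrapT => no.
  have hq j : lle (p [set u]) (q [set j]) by apply: contrapT => nj; apply: no; exists j.
  have [|I1 [I2 [d1 d2 e12]]] := @exists_meet_generators n m m_gt0 le_m_n set0.
    by rewrite cards0.
  have le_a J : #|J| = m -> lle (p [set u]) (a J).
    by move=> cJ; apply: (@core1_generate _ _ _ _ _ m_gt0 le_m_n isoa' topa _ _ cJ) => i _; exact: hq.
  have /rk_le := meet_glb (le_a _ d1) (le_a _ d2).
  have := core_rk m_gt0 le_m_n isob (c1 u); rewrite -/p cards1.
  have := isoJ_meet isoa d1 d2; rewrite e12 cards0.
  by card_lia.
have [M [jM _ cM]] : exists M, [/\ [set j] \subset M, M \subset [set: 'I_n] & #|M| = m.-1].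
  by apply: subset_between; rewrite ?subsetT // cards1 cardsT card_ord; card_lia.
have cMm : #|M| <= m by rewrite cM; card_lia.
have rkq : rk (q M : L) = r.+1.
  have := core_rk m_gt0 le_m_n isoa' cMm; rewrite -/q cM /=.
  have := rk_max (q M : L).
  have := isoJ_rk isoa cI; have := rk_max (a I).
  move: (rk (q M : L)) (rk_bound L) => x N; card_lia.
(* A member of this pencil outside c would put p_u below [q [set j]], since j is in M. *)
have starM J : #|J| = m -> M \subset J -> image_of m c (a J) /\ lle (a J) (q M).
  move=> cJ MJ; split; last exact: (@core_le _ _ _ _ _ m_gt0 le_m_n isoa' topa _ _ cJ MJ).
  apply: contrapT => nJ; apply: hj; apply: lle_trans (above _ cJ nJ) _.
  by apply: (@core_le _ _ _ _ _ m_gt0 le_m_n isoa' topa _ _ cJ); exact: subset_trans MJ.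
pose U := [set i | `[< lle (p' [set i]) (q M) >]].
(* With m + 2 points of c below [q M], two m-sets in U sharing at most m - 2 indices would have a
   join of rank at least r + 2, whereas [q M] has rank r + 1. *)
have leU : #|U| <= m.+1.
  rewrite leqNgt; apply/negP => ltU.
  have [I1 [_ I1U d1]] : exists I1, [/\ set0 \subset I1, I1 \subset U & #|I1| = m].
    by apply: subset_between; rewrite ?sub0set // cards0 /=; card_lia.
  have [K [_ KI1 cK]] : exists K, [/\ set0 \subset K, K \subset I1 & #|K| = m - 2].
    by apply: subset_between; rewrite ?sub0set // cards0 d1 /=; card_lia.
  have cKU : #|K :|: (U :\: I1)| = (m - 2) + (#|U| - m).
    have KD : K :&: (U :\: I1) = set0.
      apply/eqP; rewrite -subset0; apply/subsetP => t /setIP[/(subsetP KI1) tI].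
      by rewrite inE tI.
    by rewrite cardsU KD cards0 subn0 cK cardsD (setIidPr I1U) d1.
  have [I2 [KI2 I2s d2]] : exists I2, [/\ K \subset I2, I2 \subset K :|: (U :\: I1) & #|I2| = m].
    by apply: subset_between; rewrite ?subsetUl // cK cKU; card_lia.
  have I2U : I2 \subset U.
    apply: subset_trans I2s _; rewrite subUset subsetDl andbT.
    exact: subset_trans I1U.
  have cI12 : #|I1 :&: I2| <= m - 2.
    rewrite -cK; apply: subset_leq_card; apply/subsetP => t /setIP[t1 /(subsetP I2s)].
    by rewrite !inE t1 /= orbF.
  have le_c J : #|J| = m -> J \subset U -> lle (c J) (q M : L).
    move=> cJ JU; apply: (@core1_generate _ _ _ _ _ m_gt0 le_m_n isoc starc _ _ cJ) => i /(subsetP JU).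
    by rewrite inE => /asboolP.
  have /rk_le := join_lub (le_c _ d1 I1U) (le_c _ d2 I2U).
  by have := isoJ_join isoc d1 d2; rewrite rkq; card_lia.
have /choice[s hs] : forall y, exists J, y \notin M -> #|J| = m /\ c J = a (y |: M).
  move=> y; have [yM|yM] := boolP (y \in M); first by exists set0.
  have [|[J cJ e] _] := starM (y |: M) _ (subsetUr _ _).
    by rewrite cardsU1 yM cM; card_lia.
  by exists J.
have sinj : {in ~: M &, injective s}.
  move=> y z; rewrite !inE => yM zM e.
  have [_ ey] := hs _ yM; have [_ ez] := hs _ zM.
  have cyM t : t \notin M -> #|t |: M| = m by move=> tM; rewrite cardsU1 tM cM; card_lia.
  have : y |: M = z |: M by apply: (isoJ_inj isoa); rewrite ?cyM // -ey e ez.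
  by move/setP => /(_ y); rewrite !inE eqxx (negPf yM) !orbF => /esym/eqP.
(* The n - m + 1 members of the pencil inject into the m-subsets of U, of which there are at most m
   + 1; this contradicts 2m < n. *)
have sub : s @: (~: M) \subset [set J : {set 'I_n} | (J \subset U) && (#|J| == m)].
  apply/subsetP => J /imsetP[y]; rewrite inE => yM ->.
  have [cs es] := hs _ yM; rewrite inE cs eqxx andbT.
  apply/subsetP => i iJ; rewrite inE; apply/asboolP.
  have le1 : lle (p' [set i]) (c (s y)).
    by apply: (@core_le _ _ _ _ _ m_gt0 le_m_n isoc starc) => //; rewrite sub1set.
  apply: lle_trans le1 _; rewrite es.
  have [|_ //] := starM (y |: M) _ (subsetUr _ _).
  by rewrite cardsU1 yM cM; card_lia.
have := subset_leq_card sub; rewrite card_in_imset // cards_draws.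
have : 'C(#|U|, m) <= 'C(m.+1, m) by exact: leq_bin2l.
by rewrite binSn; have := cardsC M; rewrite card_ord cM; card_lia.
Qed.

End Mixed.

(** * Complementing index sets *)

Section Complement.
Variables (n m m' : nat) (L : ranked_lattice) (r : nat).
Implicit Types (I J K M : {set 'I_n}) (g h : {set 'I_n} -> L).
Hypothesis mm' : m + m' = n.

Lemma card_compl I : #|I| = m -> #|~: I| = m'.
Proof. by move=> cI; have := cardsC I; rewrite card_ord cI; card_lia. Qed.

Lemma card_complI I J : #|I| = m -> #|J| = m -> #|~: I :&: ~: J| + m = #|I :&: J| + m'.
Proof.
move=> cI cJ; rewrite -setCU; have := cardsC (I :|: J); have := cardsUI I J.
by rewrite card_ord; card_lia.
Qed.

Lemma isoJ_compl g : isoJ m' r g -> isoJ m r (fun I => g (~: I)).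
Proof.
move=> iso I J cI cJ; have [-> e] := iso _ _ (card_compl cI) (card_compl cJ).
by split=> //; have := card_complI cI cJ; card_lia.
Qed.

End Complement.

Lemma image_of_compl (n m m' : nat) (L : ranked_lattice) (g : {set 'I_n} -> L) x :
  m + m' = n -> image_of m (fun I => g (~: I)) x <-> image_of m' g x.
Proof.
move=> mm'; split=> -[I cI <-]; exists (~: I); rewrite ?setCK //.
  exact: (card_compl mm' cI).
by apply: (card_compl _ cI); rewrite addnC.
Qed.

Lemma outside_compl (n m m' : nat) (L : ranked_lattice) (g h : {set 'I_n} -> L) :
  m + m' = n ->
  #|outside m (fun I => g (~: I)) (fun I => h (~: I))| = #|outside m' g h|.
Proof.
move=> mm'; rewrite -(card_imset _ (@setC_inj _)).
congr #|pred_of_set _|; apply/setP => I; rewrite -{1}[I]setCK mem_imset; last exact: setC_inj.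
rewrite !inE setCK (asbool_equiv_eq (image_of_compl _ _ mm')); congr (_ && _).
apply/eqP/eqP => cI; last by apply: (card_compl _ cI); rewrite addnC.
by rewrite -[I]setCK (card_compl mm').
Qed.

(** For n = 2m the complements J1, J2, J of a pencil triangle lie in a common (m+1)-set. If their
    images formed a top, a further set S, made of J1 :&: J2 and an index outside J1 :|: J2, would go
    below the same join, although S and J share at most m - 2 elements. *)
Lemma star_type_compl (n m : nat) (L : ranked_lattice) (r : nat) (g : {set 'I_n} -> L) :
  1 < m -> m + m = n -> isoJ m r g -> @star_type n m (dual L) g ->
  star_type m (fun I => g (~: I)).
Proof.
move=> m_gt1 mm iso top I1 I2 I c1' c2' cI' c12' sI.
have [c1 c2 cI] := And3 (card_compl mm c1') (card_compl mm c2') (card_compl mm cI').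
have c12 : #|~: I1 :&: ~: I2|.+1 = m.
  by have := card_complI mm c1' c2'; card_lia.
have {sI} : ~: I \subset ~: I1 :|: ~: I2 by rewrite -setCI setCS.
move: (~: I1) (~: I2) (~: I) c1 c2 cI c12 => J1 J2 J c1 c2 cJ c12 sJ.
have [->|n1] := eqVneq J J1; first exact: meetl.
have [->|n2] := eqVneq J J2; first exact: meetr.
have cU : #|J1 :|: J2| = m.+1 by have := cardsUI J1 J2; card_lia.
have inter (A : {set 'I_n}) : #|A| = m -> A \subset J1 :|: J2 -> J != A -> #|A :&: J|.+1 = m.
  move=> cA sA neq; have : #|A :|: J| <= m.+1 by rewrite -cU subset_leq_card // subUset sA.
  have := cardsUI A J.
  have : #|A :&: J| < m.
    rewrite ltn_neqAle -{2}cA subset_leq_card ?subsetIl // andbT.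
    apply: contraNneq neq => e; have e1 : A :&: J = A.
      by apply/eqP; rewrite eqEcard subsetIl e cA leqnn.
    by rewrite eq_sym eqEcard -{1}e1 subsetIr cA cJ leqnn.
  by card_lia.
have i1 := inter _ c1 (subsetUl _ _) n1; have i2 := inter _ c2 (subsetUr _ _) n2.
have adj (A B : {set 'I_n}) : #|A| = m -> #|B| = m -> #|A :&: B|.+1 = m -> adjacent r (g A) (g B).
  by move=> cA cB cAB; rewrite /adjacent; have := isoJ_meet iso cA cB; card_lia.
have rkg := isoJ_rk iso.
have [//|le_j] := triangle_star_or_top (rkg _ c1) (rkg _ c2) (rkg _ cJ)
  (adj _ _ c1 cJ i1) (adj _ _ c2 cJ i2) (adj _ _ c1 c2 c12).
have [y yU] : exists y, y \in ~: (J1 :|: J2).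
  by apply/card_gt0P; have := cardsC (J1 :|: J2); rewrite card_ord cU; card_lia.
set S := y |: (J1 :&: J2).
have cS : #|S| = m.
  by rewrite cardsU1 -c12; move: yU; rewrite !inE negb_or => /andP[/negPf-> _].
have le_S : lle (g S) (join (g J1) (g J2)) := top J1 J2 S c1 c2 cS c12 (subsetUr _ _).
have /rk_le := join_lub le_S le_j.
have := isoJ_join iso cS cJ; have := isoJ_join iso c1 c2.
have : #|S :&: J| <= #|(J1 :&: J) :&: (J2 :&: J)|.
  apply: subset_leq_card; apply/subsetP => t; rewrite !inE => /andP[/orP[/eqP->|/andP[-> ->] ->//]].
  by move=> /(subsetP sJ); move: yU; rewrite inE => /negPf->.
have := cardsUI (J1 :&: J) (J2 :&: J); rewrite -setIUl (setIidPr sJ).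
by card_lia.
Qed.

(** The last clause records whether the indices were complemented, because complementing reverses
    the separating pair (i, j). *)
Lemma star_representative (n m : nat) (L : ranked_lattice) (r : nat) (g : {set 'I_n} -> L) :
  1 < m -> m + m = n -> isoJ m r g ->
  exists g', [/\ isoJ m r g', star_type m g', forall x, image_of m g' x <-> image_of m g x
    & g' = g \/ g' = (fun I => g (~: I))].
Proof.
move=> m_gt1 mm iso; have [|star|top] := star_type_dichotomy m_gt1 _ iso; first by lia.
  by exists g; split => //; left.
exists (fun I => g (~: I)); split; last by right.
- exact: (isoJ_compl mm iso).
- exact: (star_type_compl m_gt1 mm iso top).
- by move=> x; exact: image_of_compl.
Qed.

(** * The exchange property for three images *)

Section ExchangeHalf.
Variables (n m : nat) (L : ranked_lattice) (r : nat) (a b c : {set 'I_n} -> L).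
Implicit Types (I J K M : {set 'I_n}).
Hypotheses (m_gt1 : 1 < m) (le_m_n : m + m <= n).
Hypotheses (isoa : isoJ m r a) (isob : isoJ m r b) (isoc : isoJ m r c).
Hypothesis sub_a : forall I, #|I| = m -> image_of m b (a I) \/ image_of m c (a I).
Hypothesis sub_b : forall I, #|I| = m -> image_of m a (b I) \/ image_of m c (b I).
Hypothesis ex_ab : exists I, #|I| = m /\ ~ image_of m b (a I).
Hypothesis ex_ba : exists I, #|I| = m /\ ~ image_of m a (b I).
Hypothesis small_cb : #|outside m c b| <= 'C(n.-2, m.-1).
Hypothesis small_ca : #|outside m c a| <= 'C(n.-2, m.-1).

Lemma exchange_half : exists i j, i != j /\
  forall I, #|I| = m -> i \in I -> j \notin I -> ~ image_of m b (a I).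
Proof.
have m_gt0 : 0 < m by lia.
have [Ia [cIa nIa]] := ex_ab; have [Ib [cIb nIb]] := ex_ba.
have [lt_m|le_n] := ltnP (m + m) n; last first.
  have mm : m + m = n by apply/eqP; rewrite eqn_leq le_m_n.
  have [a' [isoa' stara ima ea]] := star_representative m_gt1 mm isoa.
  have [b' [isob' starb imb _]] := star_representative m_gt1 mm isob.
  have [Ia' cIa' eIa] : image_of m a' (a Ia) by apply/ima; exists Ia.
  have nIa' : ~ image_of m b' (a' Ia') by rewrite eIa => /imb.
  have [i [j [ij hij]]] := star_exchange m_gt0 le_m_n isoa' stara isob' starb cIa' nIa'.
  case: ea => ea; first by exists i, j; split => // I cI iI jI /imb; rewrite -ea; exact: hij.
  exists j, i; rewrite eq_sym; split => // I cI jI iI /imb hb.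
  apply: (hij (~: I)); rewrite ?inE ?jI // ?ea ?setCK //; exact: (card_compl mm cI).
have lt2 : m + 2 <= n by lia.
have [isoa' isob' isoc'] := And3 (isoJ_dual isoa) (isoJ_dual isob) (isoJ_dual isoc).
have sub_a' I : #|I| = m -> image_of m c (a I) \/ image_of m b (a I).
  by move=> cI; have [] := sub_a cI; [right | left].
have sub_b' I : #|I| = m -> image_of m c (b I) \/ image_of m a (b I).
  by move=> cI; have [] := sub_b cI; [right | left].
(* When a and b have opposite types, c shares its type with one of them, and [mixed_sub] puts c
   inside that one. [odd_a] and [odd_b] exclude both inclusions. *)
have odd_a : (forall I, #|I| = m -> image_of m b (c I)) -> False.
  move=> cb; apply: nIa; have [//|[J cJ <-]] := sub_a cIa; exact: cb.
have odd_b : (forall I, #|I| = m -> image_of m a (c I)) -> False.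
  move=> ca; apply: nIb; have [//|[J cJ <-]] := sub_b cIb; exact: ca.
have [sa|ta] := star_type_dichotomy m_gt1 lt2 isoa;
have [sb|tb] := star_type_dichotomy m_gt1 lt2 isob.
- exact: (star_exchange m_gt0 le_m_n isoa sa isob sb cIa nIa).
- exfalso; have [sc|tc] := star_type_dichotomy m_gt1 lt2 isoc.
    by apply: odd_b => I cI; apply: (mixed_sub m_gt1 lt_m isob isoc isoa).
  (* Dualizing twice restores order and meet, so star type in L is top type in [dual L]. *)
  by apply: odd_a => I cI; apply: (@mixed_sub n m (dual L) _ a c b m_gt1 lt_m isoa' isoc' isob').
- exfalso; have [sc|tc] := star_type_dichotomy m_gt1 lt2 isoc.
    by apply: odd_a => I cI; apply: (mixed_sub m_gt1 lt_m isoa isoc isob).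
  by apply: odd_b => I cI; apply: (@mixed_sub n m (dual L) _ b c a m_gt1 lt_m isob' isoc' isoa').
- exact: (@star_exchange n m (dual L) _ a b m_gt0 le_m_n isoa' ta isob' tb Ia cIa nIa).
Qed.

End ExchangeHalf.

(** For 2m > n the complemented parametrizations satisfy the hypotheses of [exchange_half] with n -
    m; the bound persists because (m - 1) + (n - m - 1) = n - 2. *)
Lemma exchange (n m : nat) (L : ranked_lattice) (r : nat) (a b c : {set 'I_n} -> L) :
  1 < m -> m + 2 <= n -> isoJ m r a -> isoJ m r b -> isoJ m r c ->
  (forall I : {set 'I_n}, #|I| = m -> image_of m b (a I) \/ image_of m c (a I)) ->
  (forall I : {set 'I_n}, #|I| = m -> image_of m a (b I) \/ image_of m c (b I)) ->
  (exists I : {set 'I_n}, #|I| = m /\ ~ image_of m b (a I)) ->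
  (exists I : {set 'I_n}, #|I| = m /\ ~ image_of m a (b I)) ->
  #|outside m c b| <= 'C(n.-2, m.-1) -> #|outside m c a| <= 'C(n.-2, m.-1) ->
  exists i j, i != j /\
    forall I : {set 'I_n}, #|I| = m -> i \in I -> j \notin I -> ~ image_of m b (a I).
Proof.
move=> m_gt1 le2 isoa isob isoc sub_a sub_b ex_ab ex_ba scb sca.
have [le_m|lt_m] := leqP (m + m) n; first exact: (exchange_half m_gt1 le_m isoa isob isoc sub_a sub_b ex_ab ex_ba scb sca).
pose m' := n - m; have mm' : m' + m = n by rewrite /m'; lia.
have m'm : m + m' = n by rewrite addnC.
pose co (g : {set 'I_n} -> L) I := g (~: I).
have imco (g : {set 'I_n} -> L) x : image_of m' (co g) x = image_of m g x.
  apply: propext; exact: (image_of_compl g x mm').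
have cc I := @card_compl n m' m mm' I; have cc' I := @card_compl n m m' m'm I.
have bin : 'C(n.-2, m'.-1) = 'C(n.-2, m.-1).
  have -> : m'.-1 = n.-2 - m.-1 by rewrite /m'; lia.
  by rewrite bin_sub //; lia.
have [i [j [ij hij]]] : exists i j, i != j /\ forall I : {set 'I_n}, #|I| = m' ->
    i \in I -> j \notin I -> ~ image_of m' (co b) (co a I).
  apply: (@exchange_half n m' L r (co a) (co b) (co c)); rewrite ?bin.
  - by rewrite /m'; lia.
  - by rewrite /m'; lia.
  - exact: (isoJ_compl mm' isoa).
  - exact: (isoJ_compl mm' isob).
  - exact: (isoJ_compl mm' isoc).
  - by move=> I /cc cI; rewrite !imco; exact: sub_a.
  - by move=> I /cc cI; rewrite !imco; exact: sub_b.
  - have [I [cI nI]] := ex_ab; exists (~: I); split; first exact: cc'.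
    by rewrite imco /co setCK.
  - have [I [cI nI]] := ex_ba; exists (~: I); split; first exact: cc'.
    by rewrite imco /co setCK.
  - by rewrite (outside_compl c b mm').
  - by rewrite (outside_compl c a mm').
exists j, i; rewrite eq_sym; split => // I cI jI iI hb.
apply: (hij (~: I)); rewrite ?inE ?jI //; first exact: cc'.
by rewrite imco /co setCK.
Qed.

(** * Linear algebra over a division ring *)

Section LinearAlgebra.
Local Open Scope ring_scope.
Variables (R : unitRingType) (V : lmodType R).
Implicit Types (S T U : set V) (s t u c : seq V) (a : R) (v w x y z : V).

Lemma subspaceP S : subspace S <->
  S 0 /\ forall a v w, S v -> S w -> S (a *: v + w).
Proof.
split=> [[S0 SD]|[S0 SD]].
  split; first exact: set_mem S0.
  by move=> a v w /mem_set Sv /mem_set Sw; apply: set_mem; exact: SD.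
split; first exact: mem_set S0.
by move=> a v w /set_mem Sv /set_mem Sw; apply: mem_set; exact: SD.
Qed.

Section Subspace.
Variable S : set V.
Hypothesis subS : subspace S.

Lemma subspace0 : S 0.
Proof. by case/subspaceP: subS. Qed.

Lemma subspaceZD a v w : S v -> S w -> S (a *: v + w).
Proof. by case/subspaceP: subS => _; exact. Qed.

Lemma subspaceD v w : S v -> S w -> S (v + w).
Proof. by move=> Sv Sw; rewrite -[v]scale1r; exact: subspaceZD. Qed.

Lemma subspaceZ a v : S v -> S (a *: v).
Proof. by move=> Sv; rewrite -[_ *: _]addr0; apply: subspaceZD => //; exact: subspace0. Qed.

Lemma subspaceB v w : S v -> S w -> S (v - w).
Proof. by move=> Sv Sw; rewrite addrC -scaleN1r; exact: subspaceZD. Qed.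

Lemma subspace_sum (I : finType) (c : I -> R) (b : I -> V) :
  (forall i, c i = 0 \/ S (b i)) -> S (\sum_i c i *: b i).
Proof.
move=> h; elim/big_ind: _ => [||i _]; [exact: subspace0|exact: subspaceD|].
by have [->|/subspaceZ//] := h i; rewrite scale0r; exact: subspace0.
Qed.

End Subspace.

Lemma subspaceI S T : subspace S -> subspace T -> subspace (S `&` T)%classic.
Proof.
move=> sS sT; apply/subspaceP; split; first by split; exact: subspace0.
by move=> a v w [Sv Tv] [Sw Tw]; split; exact: subspaceZD.
Qed.

Definition add_space S T : set V :=
  fun w => exists v v', [/\ S v, T v' & w = v + v'].

Lemma subspace_add S T : subspace S -> subspace T -> subspace (add_space S T).
Proof.
move=> sS sT; apply/subspaceP; split.
  by exists 0, 0; split; rewrite ?addr0 //; exact: subspace0.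
move=> a _ _ [v [v' [Sv Tv ->]]] [w [w' [Sw Tw ->]]].
exists (a *: v + w), (a *: v' + w'); split; [exact: subspaceZD|exact: subspaceZD|].
by rewrite scalerDr addrACA.
Qed.

Lemma lspan_subspace (A : set V) : subspace (lspan A).
Proof.
apply/subspaceP; split; first by move=> T [sT _]; exact: subspace0.
by move=> a v w hv hw T [sT AT]; apply: subspaceZD => //; [apply: hv | apply: hw].
Qed.

Lemma sub_lspan (A : set V) v : A v -> lspan A v.
Proof. by move=> Av T [_ AT]; exact: AT. Qed.

Lemma lspan_min (A : set V) S : subspace S -> (forall v, A v -> S v) ->
  forall v, lspan A v -> S v.
Proof. by move=> sS AS v; apply. Qed.

(** Spans of lists, peeled off at the head, make the exchange arguments plain inductions; [has_dimP]
    connects them with indexed bases. *)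
Fixpoint span s : set V :=
  if s is x :: s' then fun v => exists a w, span s' w /\ v = a *: x + w
  else fun v => v = 0.

(* Over a division ring this is linear independence. *)
Fixpoint free s : Prop :=
  if s is x :: s' then ~ span s' x /\ free s' else True.

Lemma span_subspace s : subspace (span s).
Proof.
apply/subspaceP; elim: s => [|x s [IH0 IH]] /=.
  by split => // a v w -> ->; rewrite scaler0 addr0.
split; first by exists 0, 0; rewrite scale0r addr0.
move=> a _ _ [a1 [w1 [h1 ->]]] [a2 [w2 [h2 ->]]].
exists (a * a1 + a2), (a *: w1 + w2); split; first exact: IH.
by rewrite scalerDr scalerA scalerDl addrACA.
Qed.

Lemma span0 s : span s 0.
Proof. by apply: subspace0; exact: span_subspace. Qed.

Lemma span_cons x s v : span s v -> span (x :: s) v.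
Proof. by move=> sv; exists 0, v; rewrite scale0r add0r. Qed.

Lemma span_head x s : span (x :: s) x.
Proof. by exists 1, 0; rewrite scale1r addr0; split => //; exact: span0. Qed.

Lemma span_mem s x : x \in s -> span s x.
Proof.
elim: s => //= y s IH; rewrite inE => /predU1P[->|xs]; first exact: span_head.
by apply: span_cons; exact: IH.
Qed.

Lemma span_min S s : subspace S -> (forall x, x \in s -> S x) ->
  forall v, span s v -> S v.
Proof.
move=> sS; elim: s => [|x s IH] hs v /=; first by move->; exact: subspace0.
move=> [a [w [sw ->]]]; apply: subspaceZD => //; first exact/hs/mem_head.
by apply: IH => // y ys; apply: hs; rewrite inE ys orbT.
Qed.

Lemma span_cat s t v : span (s ++ t) v <-> add_space (span s) (span t) v.
Proof.
have ss := span_subspace; split; last first.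
  move=> [x [y [sx ty ->]]]; apply: subspaceD; first exact: ss.
    by apply: span_min sx => [|z zs]; [exact: ss | apply: span_mem; rewrite mem_cat zs].
  by apply: span_min ty => [|z zs]; [exact: ss | apply: span_mem; rewrite mem_cat zs orbT].
apply: span_min => [|x]; first by apply: subspace_add; exact: ss.
rewrite mem_cat => /orP[xs|xt].
  by exists x, 0; rewrite addr0; split => //; [exact: span_mem | exact: span0].
by exists 0, x; rewrite add0r; split => //; [exact: span0 | exact: span_mem].
Qed.

Lemma lspan_span (A : set V) s : (forall x, A x <-> x \in s) -> lspan A = span s.
Proof.
move=> h; apply/funext => v; apply/propext; split.
  by apply: lspan_min; [exact: span_subspace | move=> x /h; exact: span_mem].
by apply: span_min; [exact: lspan_subspace | move=> x /h; exact: sub_lspan].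
Qed.

Lemma lin_comb_span (n : nat) (b : 'I_n -> V) (l : seq 'I_n) v :
  span [seq b i | i <- l] v ->
  exists c : 'I_n -> R, (forall i, i \notin l -> c i = 0) /\ v = \sum_i c i *: b i.
Proof.
elim: l v => [|i l IH] v /=.
  move=> ->; exists (fun _ => 0); split => //.
  by rewrite big1 // => j _; rewrite scale0r.
move=> [a [w [/IH[c [c0 ->]] ->]]].
exists (fun j => (if j == i then a else 0) + c j); split.
  by move=> j; rewrite inE negb_or => /andP[/negPf-> /c0->]; rewrite addr0.
under [RHS]eq_bigr do rewrite scalerDl.
rewrite big_split /=; congr (_ + _); rewrite (bigD1 i) //= eqxx big1 ?addr0 //.
by move=> j /negPf->; rewrite scale0r.
Qed.

Lemma free_lin_indep (n : nat) (b : 'I_n -> V) (l : seq 'I_n) :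
  lin_indep b -> uniq l -> free [seq b i | i <- l].
Proof.
move=> indep; elim: l => //= i l IH /andP[il ul]; split; last exact: IH.
move=> /lin_comb_span[c [c0 e]].
have := indep (fun j => c j - (if j == i then 1 else 0)).
rewrite (_ : \sum_j _ = 0) => [/(_ erefl i)|].
  by rewrite eqxx c0 // sub0r => /eqP; rewrite oppr_eq0 oner_eq0.
under eq_bigr do rewrite scalerBl.
rewrite sumrB -e (bigD1 i) //= eqxx scale1r big1 ?addr0 ?subrr //.
by move=> j /negPf->; rewrite scale0r.
Qed.

Hypothesis hR : division_ring R.

Lemma span_exchange a v w s : a != 0 -> span s w -> span s (a *: v + w) -> span s v.
Proof.
move=> a0 sw savw; have ss := span_subspace s.
rewrite -[v]scale1r -(mulVr (hR a0)) -scalerA.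
by apply: subspaceZ => //; rewrite -[_ *: v](addrK w); exact: subspaceB.
Qed.

Lemma lin_indep_free s : free s -> lin_indep (fun i : 'I_(size s) => s`_i).
Proof.
elim: s => [|x s IH] /=; first by move=> _ c _ [].
move=> [xs /IH indep] c; rewrite big_ord_recl /= => e.
have c0 : c ord0 = 0.
  apply/eqP/negPn/negP => c0; apply: xs; apply: (span_exchange c0 (w := \sum_(i < size s) c (lift ord0 i) *: s`_i)).
    by apply: subspace_sum; [exact: span_subspace | right; apply/span_mem/mem_nth].
  by rewrite e; exact: span0.
move: e; rewrite c0 scale0r add0r => /indep c1 i.
by have [j ->|->] := unliftP ord0 i.
Qed.

Lemma has_dimP d S : has_dim d S <-> exists s, [/\ free s, size s = d & span s = S].
Proof.
split=> [[b [indep <-]]|[s [fs <- <-]]].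
  exists [seq b i | i <- enum 'I_d]; rewrite size_map size_enum_ord; split => //.
    by apply: free_lin_indep => //; exact: enum_uniq.
  apply/esym/lspan_span => x; split=> [[i _ <-]|/mapP[i _ ->]]; last by exists i.
  by apply: map_f; rewrite mem_enum.
exists (fun i : 'I_(size s) => s`_i); split; first exact: lin_indep_free.
apply: lspan_span => x; split=> [[i _ <-]|xs]; first exact: mem_nth.
by exists (Ordinal (etrans (index_mem x s) xs)) => //=; rewrite nth_index.
Qed.

(** Induction on s: to drop its head x, either t already lies in the span of the tail, or one vector
    is spent on eliminating x from the others. That vector y, in the span of t but not of the tail,
    is kept for further eliminations. *)
Lemma steinitz s t : free t -> (forall x, x \in t -> span s x) -> (size t <= size s)%N.
Proof.
have ss := span_subspace.
elim: s t => [|x s IH] t ft ht.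
  case: t ft ht => //= y t [yt _] h; case: yt; rewrite (h y (mem_head _ _)).
  exact: span0.
suff [hs|[t' [y [ft' et ht' _ _]]]] : (forall z, z \in t -> span s z) \/
  exists t' y, [/\ free t', size t = (size t').+1, forall z, z \in t' -> span s z,
    forall z, span t' z -> span t z & span t y /\ ~ span s y].
- by apply: leqW; exact: IH.
- by rewrite et ltnS; exact: IH.
elim: t ft ht => [|z t IHt] /=; first by left.
move=> [zt ft] ht; have htt y : y \in t -> span (x :: s) y.
  by move=> yt; apply: ht; rewrite inE yt orbT.
have [hs|[t' [y [ft' et ht' tt' [ty sy]]]]] := IHt ft htt.
  have [sz|nz] := pselect (span s z).
    by left=> y; rewrite inE => /predU1P[->|/hs].
  right; exists t, z; split => //; last by split => //; exact: span_head.
  by move=> y; exact: span_cons.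
right; have [a [w [sw ey]]] : span (x :: s) y by apply: span_min ty => //; exact: ss.
have [c [w' [sw' ez]]] : span (x :: s) z by apply: ht; exact: mem_head.
have a0 : a != 0 by apply/eqP => a0; apply: sy; rewrite ey a0 scale0r add0r.
(* With y = a x + w and z = c x + w', this multiple of y cancels the x-component of z; scalars act
   on the left, hence the order of the product. *)
pose z' := z - (c * a^-1) *: y.
have sz' : span s z'.
  rewrite /z' ez ey scalerDr scalerA mulrVK; last exact: hR.
  rewrite opprD addrACA subrr add0r; apply: subspaceB => //; exact: subspaceZ.
exists (z' :: t'), y; split.
- split => // /tt' tz'; apply: zt; rewrite -(subrK ((c * a^-1) *: y) z).
  by apply: subspaceD => //; exact: subspaceZ.
- by rewrite /= et.
- by move=> u; rewrite inE => /predU1P[->|/ht'].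
- apply: (span_min (ss (z :: t))) => u.
  rewrite inE => /predU1P[->|/span_mem /tt' tu]; last exact: span_cons.
  apply: (subspaceB (ss (z :: t))); first exact: span_head.
  by apply: (subspaceZ (ss (z :: t))); exact: span_cons.
- by split=> //; exact: span_cons.
Qed.

Lemma has_dim_uniq d d' S : has_dim d S -> has_dim d' S -> d = d'.
Proof.
move=> /has_dimP[s [fs <- es]] /has_dimP[t [ft <- et]].
apply/eqP; rewrite eqn_leq; apply/andP.
by split; apply: steinitz => // x /span_mem; rewrite es et.
Qed.

Section FiniteDim.
Variable n : nat.
Hypothesis dimV : has_dim n [set: V]%classic.

Lemma free_size s : free s -> (size s <= n)%N.
Proof.
move=> fs; case/has_dimP: dimV => t [ft <- et].
by apply: steinitz => // x _; rewrite et.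
Qed.

Lemma extend_basis S s : subspace S -> free s -> (forall x, x \in s -> S x) ->
  exists t, free (t ++ s) /\ span (t ++ s) = S.
Proof.
move=> sS; move: {2}(n - size s)%N (leqnn (n - size s)) => d.
elim: d s => [|d IH] s le_d fs hs.
all: have [[v Sv nv]|no] := pselect (exists2 v, S v & ~ span s v); last first.
1,3: exists [::]; split => //=; apply/funext => v; apply/propext; split.
1,3: by apply: span_min.
1,2: by move=> Sv; apply: contrapT => nv; apply: no; exists v.
  have /free_size /= : free (v :: s) by [].
  lia.
have fvs : free (v :: s) by [].
have := free_size fvs; rewrite /= => lt_n.
have [|//||t [ft et]] := IH (v :: s); first by rewrite /=; lia.
  by move=> x; rewrite inE => /predU1P[->|/hs].
by exists (rcons t v); rewrite cat_rcons.
Qed.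

Lemma subspace_has_dim S : subspace S -> exists d, has_dim d S.
Proof.
move=> sS; have [//|//|t [ft et]] := @extend_basis S [::] sS.
by rewrite cats0 in ft et; exists (size t); apply/has_dimP; exists t.
Qed.

(** Extensions of c inside two subspaces stay independent together because the subspaces intersect
    only in the span of c. *)
Lemma free_amalgam t c u : free (t ++ c) -> free u -> (forall v, span c v -> span u v) ->
  (forall v, span (t ++ c) v -> span u v -> span c v) -> free (t ++ u).
Proof.
elim: t => //= z t IH [zt ft] fu cu h; split; last first.
  by apply: IH => // v tv; apply: h; exact: span_cons.
move/span_cat => [x [y [tx uy ez]]]; apply: zt; apply/span_cat.
exists x, y; split => //; apply: h => //; have ss := span_subspace (z :: t ++ c).
have -> : y = z - x by rewrite ez addrAC subrr add0r.
apply: (subspaceB ss); first exact: span_head.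
apply: span_cons; apply/span_cat; exists x, 0; rewrite addr0; split => //.
exact: span0.
Qed.

Lemma adapted_basis S T : subspace S -> subspace T -> exists t s c,
  [/\ free (t ++ s ++ c), span c = (S `&` T)%classic, span (s ++ c) = S & span (t ++ c) = T].
Proof.
move=> sS sT; have [//|//|c [fc ec]] := extend_basis (subspaceI sS sT) (s := [::]).
rewrite cats0 in fc ec.
have cS x : x \in c -> S x by move=> /span_mem; rewrite ec => -[].
have cT x : x \in c -> T x by move=> /span_mem; rewrite ec => -[].
have [s [fs es]] := extend_basis sS fc cS; have [t [ft et]] := extend_basis sT fc cT.
exists t, s, c; split => //; apply: free_amalgam ft fs _ _; rewrite ?es ?et ec.
  by move=> v [].
by move=> v Tv Sv; split.
Qed.

Definition dim S : nat := xget 0%N (fun d => has_dim d S).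

Lemma dimE d S : has_dim d S -> dim S = d.
Proof.
by move=> hd; apply: (has_dim_uniq (S := S)) => //; rewrite /dim; apply: (@xgetPex _ 0%N (fun d => has_dim d S)); exists d.
Qed.

Lemma has_dim_dim S : subspace S -> has_dim (dim S) S.
Proof. by move=> /subspace_has_dim[d hd]; rewrite (dimE hd). Qed.

Lemma dim_span s : free s -> dim (span s) = size s.
Proof. by move=> fs; apply: dimE; apply/has_dimP; exists s. Qed.

Lemma has_dim_subspace d S : has_dim d S -> subspace S.
Proof. by move=> [b [_ <-]]; exact: lspan_subspace. Qed.

Lemma dim_modular S T : subspace S -> subspace T ->
  (dim (S `&` T)%classic + dim (add_space S T) = dim S + dim T)%N.
Proof.
move=> sS sT; have [t [s [c [f ec es et]]]] := adapted_basis sS sT.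
have eD : add_space S T = span (t ++ s ++ c).
  apply/funext => v; apply/propext; rewrite -es -et; split.
    move=> [x [y [sx ty ->]]]; have ss := span_subspace (t ++ s ++ c).
    apply: subspaceD => //.
      by apply: span_min sx => // z zs; apply: span_mem; rewrite mem_cat zs orbT.
    apply: span_min ty => // z; rewrite mem_cat => zs; apply: span_mem.
    by rewrite !mem_cat; case/orP: zs => ->; rewrite ?orbT.
  apply: span_min; first by apply: subspace_add; exact: span_subspace.
  have s0 u : span u 0 by exact: span0.
  move=> z; rewrite mem_cat => /orP[zt|/span_mem sz].
    exists 0, z; rewrite add0r; split => //.
    by apply: span_mem; rewrite mem_cat zt.
  by exists z, 0; rewrite addr0.
have fsub (u1 u2 : seq V) : free (u1 ++ u2) -> free u2 by elim: u1 => //= z u1 IH [_ /IH].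
have fsc := fsub _ _ f; have fc := fsub _ _ fsc.
have ftc : free (t ++ c).
  elim: t f {et eD} => //= z t IH [nz f]; split; last exact: IH.
  move=> h; apply: nz; apply: span_min h; first exact: span_subspace.
  move=> x; rewrite mem_cat => xs; apply: span_mem.
  by rewrite !mem_cat; case/orP: xs => ->; rewrite ?orbT.
rewrite eD -ec -es -et !dim_span // !size_cat; lia.
Qed.

Lemma dim_sub S T : subspace S -> subspace T -> (S `<=` T)%classic -> (dim S <= dim T)%N.
Proof.
move=> sS sT ST; have /has_dimP[s [fs es e]] := has_dim_dim sS.
have [|t [ft et]] := extend_basis sT fs.
  by move=> x /span_mem; rewrite e; exact: ST.
by rewrite -et -e !dim_span // size_cat leq_addl.
Qed.

Lemma dim_sub_eq S T : subspace S -> subspace T -> (S `<=` T)%classic ->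
  (dim T <= dim S)%N -> S = T.
Proof.
move=> sS sT ST le; have /has_dimP[s [fs es e]] := has_dim_dim sS.
have [|t [ft et]] := extend_basis sT fs.
  by move=> x /span_mem; rewrite e; exact: ST.
move: le; rewrite -{1}et -{1}e !dim_span // size_cat -[leqRHS]add0n leq_add2r leqn0.
by rewrite size_eq0 => /eqP t0; rewrite -e -et t0.
Qed.

Lemma dim_max S : subspace S -> (dim S <= n)%N.
Proof.
move=> sS; rewrite -(dimE dimV); apply: dim_sub => //.
exact: has_dim_subspace dimV.
Qed.

(** A basis of the intersection is extended to both subspaces and then to V; I and J are the
    positions of their vectors in the resulting list. *)
Lemma common_basis S T : subspace S -> subspace T -> exists (b : 'I_n -> V) (I J : {set 'I_n}),
  [/\ is_basis [set: V]%classic b, S = lspan (b @` [set` I])%classic &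
      T = lspan (b @` [set` J])%classic].
Proof.
move=> sS sT; have [t [s [c [f ec es et]]]] := adapted_basis sS sT.
have [//|w [fw ew]] := extend_basis (has_dim_subspace dimV) f.
set l := w ++ t ++ s ++ c in fw ew.
have cl : size l = n.
  by rewrite -(dimE dimV) -ew dim_span.
pose idx u : {set 'I_n} := [set i : 'I_n | l`_i \in u].
have sub_l u : {subset u <= l} ->
    lspan ((fun i : 'I_n => l`_i) @` [set` idx u])%classic = span u.
  move=> ul; apply: lspan_span => x; split; first by move=> [i /=]; rewrite inE => ? <-.
  move=> xu; have lt_x : (index x l < n)%N by rewrite -cl index_mem ul.
  by exists (Ordinal lt_x); rewrite /= ?inE nth_index ?ul.
exists (fun i => l`_i), (idx (s ++ c)), (idx (t ++ c)).
have sl : {subset s ++ c <= l}.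
  by move=> x; rewrite /l !mem_cat => /orP[]->; rewrite ?orbT.
have tl : {subset t ++ c <= l}.
  by move=> x; rewrite /l !mem_cat => /orP[]->; rewrite ?orbT.
rewrite (sub_l _ sl) (sub_l _ tl) es et; split => //; split.
  by have := lin_indep_free fw; rewrite cl.
rewrite -ew; apply: lspan_span => x; split=> [[i _ <-]|xl]; first by rewrite mem_nth ?cl.
have lt_x : (index x l < n)%N by rewrite -cl index_mem.
by exists (Ordinal lt_x) => //=; rewrite nth_index.
Qed.

End FiniteDim.
End LinearAlgebra.

(** * Distances and apartments *)

Lemma is_distE (T : Type) (e : rel T) (delta : T -> T -> nat) :
  (forall x p, path e x p -> delta x (last x p) <= size p) ->
  (forall x y, exists p, [/\ path e x p, last x p = y & size p = delta x y]) ->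
  forall x y d, is_dist e x y d <-> d = delta x y.
Proof.
move=> lower upper x y d; split=> [[[p [ep <- <-]] min]|->].
  apply/eqP; rewrite eqn_leq lower // andbT.
  by have [q [eq lq <-]] := upper x (last x p); exact: min.
by split; [exact: upper | move=> p ep <-; exact: lower].
Qed.

Lemma isometric_embeddingE (T U : Type) (e : rel T) (e' : rel U) delta delta' (g : T -> U) :
  (forall x y d, is_dist e x y d <-> d = delta x y) ->
  (forall x y d, is_dist e' x y d <-> d = delta' x y) ->
  isometric_embedding e e' g <->
  injective g /\ forall x y, delta' (g x) (g y) = delta x y.
Proof.
move=> he he'; split=> -[inj h]; split=> // x y.
  by have /(he' (g x) (g y)) := (h x y (delta x y)).1 ((he x y _).2 erefl).
by move=> d; rewrite he he' h.
Qed.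

Section JohnsonDistance.
Variables n k : nat.
Hypothesis k_gt0 : 0 < k.
Implicit Types A B C : johnson n k.

Lemma card_johnson A : #|val A| = k.
Proof. exact/eqP/(valP A). Qed.

Definition johnson_delta A B := k - #|val A :&: val B|.

Lemma johnson_path A p : path (@johnson_adj n k) A p -> johnson_delta A (last A p) <= size p.
Proof.
rewrite /johnson_delta; elim: p A => [|B p IH] A /=.
  by rewrite setIid card_johnson; lia.
move=> /andP[/eqP adj /IH]; set C := last B p => le_p.
have h : #|val B :&: val C| <= #|val A :&: val C| + #|val B :\: val A|.
  apply: leq_trans (leq_of_leqif (leq_card_setU _ _)); apply: subset_leq_card.
  by apply/subsetP => x; rewrite !inE => /andP[-> ->]; case: (x \in val A).
have := cardsID (val A) (val B); rewrite setIC adj card_johnson.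
by card_lia.
Qed.

(** Each step trades an element of A outside B for an element of B outside A. *)
Lemma johnson_path_exists A B : exists p,
  [/\ path (@johnson_adj n k) A p, last A p = B & size p = johnson_delta A B].
Proof.
rewrite /johnson_delta; move: {-1}(k - _) (erefl (k - #|val A :&: val B|)) => d.
elim: d A => [|d IH] A e.
  exists [::]; split => //=; apply/val_inj/eqP; rewrite eqEcard !card_johnson leqnn andbT.
  apply/setIidPl/eqP; rewrite eqEcard subsetIl card_johnson; lia.
have cA := card_johnson A; have cB := card_johnson B.
have : 0 < #|val B :\: val A|.
  by have := cardsID (val A) (val B); rewrite setIC cB; card_lia.
have : 0 < #|val A :\: val B|.
  by have := cardsID (val B) (val A); rewrite cA; card_lia.
move=> /card_gt0P[a /setDP[aA aB]] /card_gt0P[b /setDP[bB bA]].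
have cAa : #|val A :\ a| = k.-1 by have := cardsD1 a (val A); rewrite aA add1n; card_lia.
have cC : #|b |: val A :\ a| == k.
  by rewrite cardsU1 !inE (negPf bA) andbF add1n cAa prednK.
pose C : johnson n k := exist _ (b |: val A :\ a) cC.
have [|p [pC lC sC]] := IH C.
  have -> : val C :&: val B = b |: (val A :&: val B).
    apply/setP => x; rewrite !inE; case: (eqVneq x b) => [->|_] //=.
    by case: (eqVneq x a) => [->|_] //=; rewrite (negPf aB) andbF.
  by rewrite cardsU1 inE (negPf bA) /=; card_lia.
exists (C :: p); rewrite /= pC lC sC; split => //; rewrite andbT /johnson_adj /=.
rewrite (_ : _ :&: _ = val A :\ a) ?cAa //; apply/setP => x; rewrite !inE.
by case: (eqVneq x b) => [->|_] /=; rewrite ?(negPf bA) ?andbF //; case: (x \in _); rewrite ?andbF ?andbT.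
Qed.

Lemma johnson_distE A B d :
  is_dist (@johnson_adj n k) A B d <-> d = johnson_delta A B.
Proof. exact: (is_distE johnson_path johnson_path_exists). Qed.

End JohnsonDistance.

(** * The lattice of subspaces and the Grassmann distance *)

Section SubspaceLattice.
Variables (R : unitRingType) (V : lmodType R) (n : nat).
Hypotheses (hR : division_ring R) (hV : has_dim n [set: V]%classic).

Definition subspace_of := {S : set V | subspace S}.

Definition subspace_lattice : ranked_lattice.
Proof.
refine (@RankedLattice subspace_of (fun S T => (sval S `<=` sval T)%classic)
  (fun S T => exist _ _ (subspaceI (svalP S) (svalP T)))
  (fun S T => exist _ _ (subspace_add (svalP S) (svalP T)))
  (fun S => dim (sval S)) n _ _ _ _ _ _ _ _ _ _ _ _) => //=.
- by move=> S.
- by move=> T S U ST TU x /ST /TU.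
- by move=> S T U US UT x Ux; split; [exact: US | exact: UT].
- move=> S T x Sx; exists x, 0%R; rewrite addr0; split => //.
  exact: (subspace0 (svalP T)).
- move=> S T x Sx; exists 0%R, x; rewrite add0r; split => //.
  exact: (subspace0 (svalP S)).
- move=> S T U SU TU _ [x [y [/SU Ux /TU Uy ->]]].
  exact: (subspaceD (svalP U)).
- by move=> S T ST; apply: (dim_sub hR hV (svalP S) (svalP T)).
- move=> [S sS] [T sT] /= ST le; apply: eq_exist.
  exact: (dim_sub_eq hR hV sS sT).
- by move=> S T; apply: (dim_modular hR hV (svalP S) (svalP T)).
- by move=> S; apply: (dim_max hR hV (svalP S)).
Defined.

Lemma grassmannian_dim k (S : grassmannian V k) : has_dim k (val S).
Proof. exact: set_mem (valP S). Qed.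

Definition vertex_subspace k (S : grassmannian V k) : subspace_lattice :=
  exist _ (val S) (has_dim_subspace (grassmannian_dim S)).

Lemma vertex_subspace_inj k : injective (@vertex_subspace k).
Proof. by move=> S T [] /val_inj. Qed.

Lemma rk_vertex k (S : grassmannian V k) : rk (vertex_subspace S) = k.
Proof. exact: (dimE hR (grassmannian_dim S)). Qed.

Definition vertex k (S : set V) (hS : has_dim k S) : grassmannian V k :=
  exist _ S (mem_set hS).

Definition vspan (b : 'I_n -> V) (I : {set 'I_n}) : set V := lspan (b @` [set` I])%classic.

Lemma mem_vspan (b : 'I_n -> V) (I : {set 'I_n}) i : i \in I -> vspan b I (b i).
Proof. by move=> iI; apply: sub_lspan; exists i. Qed.

Lemma vspan_sub (b : 'I_n -> V) (I : {set 'I_n}) (S : set V) : subspace S ->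
  (forall i, i \in I -> S (b i)) -> (vspan b I `<=` S)%classic.
Proof. by move=> sS h; apply: lspan_min => // _ [i iI <-]; exact: h. Qed.

Lemma vspan_subspace (b : 'I_n -> V) I : subspace (vspan b I).
Proof. exact: lspan_subspace. Qed.

Lemma vspan_span (b : 'I_n -> V) I : vspan b I = span [seq b i | i <- enum I].
Proof.
apply: lspan_span => x; split=> [[i iI <-]|/mapP[i iI ->]].
  by apply: map_f; rewrite mem_enum.
by exists i => //; rewrite mem_enum in iI.
Qed.

Lemma vspan_coord (b : 'I_n -> V) (I : {set 'I_n}) (c : 'I_n -> R) : lin_indep b ->
  vspan b I (\sum_i c i *: b i)%R -> forall i, i \notin I -> c i = 0%R.
Proof.
move=> indep; rewrite vspan_span => /lin_comb_span[c' [c'0 e]] i iI.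
have := indep (fun j => c j - c' j)%R; rewrite (_ : \sum_j _ = 0)%R; last first.
  by under eq_bigr do rewrite scalerBl; rewrite sumrB e subrr.
move=> /(_ erefl i); rewrite c'0 ?mem_enum // subr0; exact.
Qed.

Lemma vspan_dim (b : 'I_n -> V) (I : {set 'I_n}) : lin_indep b -> has_dim #|I| (vspan b I).
Proof.
move=> indep; apply/(has_dimP hR); exists [seq b i | i <- enum I].
rewrite size_map -cardE vspan_span; split => //.
by apply: free_lin_indep => //; exact: enum_uniq.
Qed.

Lemma vspanI (b : 'I_n -> V) (I J : {set 'I_n}) : lin_indep b ->
  (vspan b I `&` vspan b J)%classic = vspan b (I :&: J).
Proof.
move=> indep; apply/seteqP; split; last first.
  have sub (K : {set 'I_n}) : I :&: J \subset K -> (vspan b (I :&: J) `<=` vspan b K)%classic.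
    move=> IK; apply: vspan_sub => [|i /(subsetP IK)]; first exact: vspan_subspace.
    exact: mem_vspan.
  by move=> v hv; split; apply: sub hv; rewrite ?subsetIl ?subsetIr.
move=> v [vI vJ]; move: (vI); rewrite vspan_span => /lin_comb_span[c [c0 e]].
rewrite e; apply: subspace_sum; first exact: vspan_subspace.
move=> i; have [iI|iI] := boolP (i \in I); last by left; apply: c0; rewrite mem_enum.
have [iJ|iJ] := boolP (i \in J); first by right; apply: mem_vspan; rewrite inE iI.
by left; apply: (vspan_coord indep (I := J)) => //; rewrite -e.
Qed.

Section GrassmannDistance.
Variable k : nat.
Hypothesis k_gt0 : 0 < k.
Implicit Types S T U : grassmannian V k.

Definition grassmann_delta S T := k - dim (val S `&` val T)%classic.

Lemma grassmann_adjP S T : grassmann_adj V k S T -> (dim (val S `&` val T)%classic).+1 = k.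
Proof. by move=> /asboolP/(dimE hR) ->; rewrite prednK. Qed.

Lemma grassmann_path S p : path (grassmann_adj V k) S p ->
  grassmann_delta S (last S p) <= size p.
Proof.
rewrite /grassmann_delta; elim: p S => [|T p IH] S /=.
  by rewrite classical_sets.setIid (dimE hR (grassmannian_dim S)); lia.
move=> /andP[/grassmann_adjP adj /IH]; set U := last T p.
pose s := vertex_subspace S; pose t := vertex_subspace T; pose u := vertex_subspace U.
(* The triangle inequality, from modularity: the two meets have their join below t and their meet
   below [meet s u]. *)
have h : rk (meet s t) + rk (meet t u) <= k + rk (meet s u).
  rewrite -rk_modular addnC -(rk_vertex T) leq_add //; apply: rk_le.
    by apply: join_lub; [exact: meetr | exact: meetl].
  by apply: meet_glb; [apply: lle_trans (meetl _ _) (meetl _ _)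
                      |apply: lle_trans (meetr _ _) (meetr _ _)].
move: h adj => /=; move: (dim _) (dim _) (dim _) => x y z; lia.
Qed.

Definition johnson_vertex (b : 'I_n -> V) (indep : lin_indep b) (A : johnson n k) :
    grassmannian V k :=
  vertex (eq_ind _ (fun d => has_dim d (vspan b (val A)))
                 (vspan_dim (val A) indep) _ (card_johnson A)).

Lemma johnson_vertex_meet b (indep : lin_indep b) A B :
  dim (val (johnson_vertex indep A) `&` val (johnson_vertex indep B))%classic
  = #|val A :&: val B|.
Proof. by rewrite /= vspanI //; apply: (dimE hR); exact: vspan_dim. Qed.

Lemma johnson_vertex_delta b (indep : lin_indep b) A B :
  grassmann_delta (johnson_vertex indep A) (johnson_vertex indep B) = johnson_delta A B.
Proof. by rewrite /grassmann_delta johnson_vertex_meet. Qed.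

Lemma common_apartment S T : exists b, exists2 indep : lin_indep b,
  is_basis [set: V]%classic b &
  exists A B, S = johnson_vertex indep A /\ T = johnson_vertex indep B.
Proof.
have dS := grassmannian_dim S; have dT := grassmannian_dim T.
have [b [I [J [hb eS eT]]]] := common_basis hR hV (has_dim_subspace dS) (has_dim_subspace dT).
have indep := hb.1; exists b, indep => //.
have cI : #|I| == k.
  by apply/eqP; apply: (has_dim_uniq hR _ dS); rewrite eS; exact: vspan_dim.
have cJ : #|J| == k.
  by apply/eqP; apply: (has_dim_uniq hR _ dT); rewrite eT; exact: vspan_dim.
by exists (exist _ I cI), (exist _ J cJ); split; apply: val_inj.
Qed.

(** A Johnson geodesic is transported into an apartment containing both vertices. *)
Lemma grassmann_path_exists S T : exists p,
  [/\ path (grassmann_adj V k) S p, last S p = T & size p = grassmann_delta S T].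
Proof.
have [b [indep _ [A [B [-> ->]]]]] := common_apartment S T.
have [p [pA lA sA]] := johnson_path_exists k_gt0 A B.
exists (map (johnson_vertex indep) p); rewrite size_map sA last_map lA johnson_vertex_delta.
split => //; move: A pA {lA sA} => A; elim: p A => //= C p IH A /andP[adj /IH ->].
rewrite andbT; apply/asboolP; rewrite -(eqP adj) /= vspanI //; exact: vspan_dim.
Qed.

Lemma grassmann_distE S T d :
  is_dist (grassmann_adj V k) S T d <-> d = grassmann_delta S T.
Proof. exact: (is_distE grassmann_path grassmann_path_exists). Qed.

Lemma grassmann_dim_le S T : dim (val S `&` val T)%classic <= k.
Proof.
have := rk_le (meetl (vertex_subspace S) (vertex_subspace T)).
by rewrite rk_vertex.
Qed.

End GrassmannDistance.
End SubspaceLattice.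

(** * Elementary changes of basis *)

Section Transvection.
Variables (R : unitRingType) (V : lmodType R) (n : nat).
Implicit Types (b : 'I_n -> V) (I J : {set 'I_n}) (i j l : 'I_n) (a : R).

Definition transvection i j a b b' : Prop :=
  (forall l, l != i -> b' l = b l) /\ b' i = (b i + a *: b j)%R.

Lemma transvection_exists i j a b : exists b', transvection i j a b b'.
Proof.
exists (fun l => if l == i then b i + a *: b j else b l)%R; split; last by rewrite eqxx.
by move=> l /negPf->.
Qed.

Lemma transvection_sym i j a b b' : i != j ->
  transvection i j a b b' -> transvection i j (- a)%R b' b.
Proof.
move=> ij [bl bi]; split; first by move=> l li; rewrite bl.
by rewrite bi bl 1?eq_sym // scaleNr addrK.
Qed.

Lemma transvection_sub i j a b b' I : transvection i j a b b' -> i \notin I \/ j \in I ->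
  (vspan b' I `<=` vspan b I)%classic.
Proof.
move=> [bl bi] adm; apply: vspan_sub; first exact: vspan_subspace.
move=> l lI; have [e|li] := eqVneq l i; last by rewrite bl //; exact: mem_vspan.
rewrite e in lI *; case: adm => [|jI]; first by rewrite lI.
rewrite bi addrC; apply: (subspaceZD (vspan_subspace b I)); exact: mem_vspan.
Qed.

Lemma transvection_vspan i j a b b' I : i != j -> transvection i j a b b' ->
  i \notin I \/ j \in I -> vspan b' I = vspan b I.
Proof.
move=> ij tr adm; apply/seteqP; split; first exact: transvection_sub tr adm.
exact: transvection_sub (transvection_sym ij tr) adm.
Qed.

Lemma transvection_basis i j a b b' : i != j -> transvection i j a b b' ->
  is_basis [set: V]%classic b -> is_basis [set: V]%classic b'.
Proof.
move=> ij tr [indep gen]; split; last first.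
  apply/seteqP; split => // v _; have : lspan (range b) v by rewrite gen.
  apply: lspan_min; first exact: lspan_subspace.
  move=> _ [l _ <-]; have mem t : lspan (range b') (b' t) by apply: sub_lspan; exists t.
  have [->|li] := eqVneq l i; last by case: tr => bl _; rewrite -bl.
  have [_ ->] := transvection_sym ij tr; rewrite addrC.
  by apply: (subspaceZD (lspan_subspace (range b'))).
move=> c e; case: tr => bl bi.
have {}e : (\sum_l (c l + (if l == j then c i * a else 0)) *: b l = 0)%R.
  transitivity (\sum_l c l *: b' l)%R => //.
  under eq_bigr do rewrite scalerDl; rewrite big_split /=.
  rewrite [X in (_ + X)%R](bigD1 j) //= eqxx [X in (_ + (_ + X))%R]big1 ?addr0; last first.
    by move=> l /negPf->; rewrite scale0r.
  rewrite (bigD1 i) //= [in RHS](bigD1 i) //= bi scalerDr scalerA -!addrA.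
  congr (_ + _)%R; rewrite addrC; congr (_ + _)%R.
  by apply: eq_bigr => l li; rewrite bl.
have ci : c i = 0%R by have := indep _ e i; rewrite (negPf ij) addr0.
move=> l; have := indep _ e l; rewrite ci mul0r.
by case: (l == j); rewrite addr0.
Qed.

(** If the spans agreed, b_i = b'_i - a b'_j would force j into J, and then b'_j = b_j would force j
    into I. *)
Lemma transvection_neq i j a b b' I J : i != j -> a != 0%R -> transvection i j a b b' ->
  lin_indep b -> lin_indep b' -> i \in I -> j \notin I -> vspan b I <> vspan b' J.
Proof.
move=> ij a0 tr indep indep' iI jI e.
have [_ ebi] := transvection_sym ij tr.
have sum1 (d : 'I_n -> V) t : d t = (\sum_l (if l == t then 1 else 0) *: d l)%R.
  rewrite (bigD1 t) //= eqxx scale1r big1 ?addr0 // => l /negPf->; exact: scale0r.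
have jJ : j \in J.
  apply/negPn/negP => jJ; have /eqP := a0; apply.
  have : vspan b I (b i) by exact: mem_vspan.
  rewrite e ebi.
  have -> : (b' i + - a *: b' j = \sum_l ((if l == i then 1 else 0) - (if l == j then a else 0)) *: b' l)%R.
    under eq_bigr do rewrite scalerBl; rewrite sumrB -sum1 scaleNr; congr (_ - _)%R.
    by rewrite (bigD1 j) //= eqxx big1 ?addr0 // => l /negPf->; exact: scale0r.
  move=> /(vspan_coord indep')/(_ j jJ); rewrite eqxx eq_sym (negPf ij) sub0r.
  by move/eqP; rewrite oppr_eq0 => /eqP.
have : vspan b' J (b' j) by exact: mem_vspan.
 rewrite -e; case: tr => bl _; rewrite bl 1?eq_sym //.
rewrite {1}sum1 => /(vspan_coord indep)/(_ j jI); rewrite eqxx => /eqP.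
by rewrite oner_eq0.
Qed.

(** The new vector b_i + b_j has index i in b' and index j in b''; this makes each of the three
    apartments lie in the union of the others. *)
Lemma transvection_swap i j b b' b'' I : i != j ->
  transvection i j 1%R b b' -> transvection j i 1%R b b'' ->
  i \in I -> j \notin I -> vspan b' I = vspan b'' (j |: I :\ i).
Proof.
move=> ij [bl bi] [bl' bj] iI jI.
have e : b' i = b'' j by rewrite bi bj !scale1r addrC.
apply/seteqP; split; apply: vspan_sub; try exact: vspan_subspace.
  move=> l lI; have [->|li] := eqVneq l i; first by rewrite e; apply: mem_vspan; rewrite !inE eqxx.
  have lj : l != j by apply: contraNneq jI => <-.
  by rewrite bl // -(bl' l lj); apply: mem_vspan; rewrite !inE li lI orbT.
move=> l; rewrite !inE => /predU1P[->|/andP[li lI]]; first by rewrite -e; exact: mem_vspan.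
have lj : l != j by apply: contraNneq jI => <-.
by rewrite bl' // -(bl l li); apply: mem_vspan.
Qed.

End Transvection.

(** * Recovering intersection sizes from separating pairs *)

Section Counting.
Variables n k : nat.
Local Notation T := {A : {set 'I_n} | #|A| == k}.
Implicit Types (A B : T) (i j u v : 'I_n).

Lemma surjective_injective (X : finType) (f : X -> X) :
  (forall y, exists x, f x = y) -> injective f.
Proof. by move=> /choice[g gK]; exact: (can_inj (canF_sym gK)). Qed.

Lemma card_val A : #|val A| = k. Proof. exact/eqP/(valP A). Qed.

Lemma separating_set (D E : {set 'I_n}) : [disjoint D & E] -> #|D| <= k ->
  #|E| + k <= n -> exists A, D \subset val A /\ [disjoint val A & E].
Proof.
move=> dDE cD cE; have [||I [DI IE cI]] := @subset_between n k D (~: E).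
- by rewrite -disjoints_subset.
- by have := cardsC E; rewrite card_ord cD; card_lia.
have cI' : #|I| == k by rewrite cI.
by exists (exist _ I cI'); rewrite /= disjoints_subset.
Qed.

Hypotheses (k_gt1 : 1 < k) (lt_k : k + 2 <= n).
Variable t : T -> T.
Hypothesis t_inj : injective t.
Hypothesis ht : forall i j, i != j -> exists u v, u != v /\
  forall A, (i \in val A) && (j \notin val A) = (u \in val (t A)) && (v \notin val (t A)).

(** If i != i', some A contains i and avoids j and i', as k + 2 <= n. If j != j', some A contains i
    and j' and avoids j, as k >= 2. *)
Lemma separating_inj i j i' j' : i != j -> i' != j' ->
  (forall A, (i \in val A) && (j \notin val A) = (i' \in val A) && (j' \notin val A)) ->
  i = i' /\ j = j'.
Proof.
move=> ij ij' h.
have disj (a b c d : 'I_n) : a != c -> a != d -> b != c -> b != d ->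
    [disjoint [set a; b] & [set c; d]].
  move=> ac ad bc bd; rewrite disjoints_subset; apply/subsetP => x; rewrite !inE negb_or.
  by case/orP => /eqP->; rewrite ?ac ?ad ?bc ?bd.
have c2 (a b : 'I_n) : #|[set a; b]| <= 2 by rewrite cards2; case: (a != b).
split; apply/eqP/negPn/negP => neq.
  have [|||A [iA dA]] := @separating_set [set i; i] [set j; i'].
  - exact: disj.
  - by rewrite setUid cards1; lia.
  - by have := c2 j i'; card_lia.
  have := h A; have iA' : i \in val A by apply: (subsetP iA); rewrite !inE eqxx.
  have nA x : x \in [set j; i'] -> x \in val A = false by exact: disjointFl dA.
  by rewrite iA' (nA j) ?(nA i') // !inE eqxx ?orbT.
have [ij2|ij2] := eqVneq i j'.
  have [|||A [iA dA]] := @separating_set [set i; i] [set j; j].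
  - exact: disj.
  - by rewrite setUid cards1; lia.
  - by rewrite setUid cards1; lia.
  have := h A; have iA' : i \in val A by apply: (subsetP iA); rewrite !inE eqxx.
  have jA : j \in val A = false.
    by apply: (disjointFl dA); rewrite !inE eqxx.
  by rewrite -ij2 iA' jA andbF.
have [|||A [iA dA]] := @separating_set [set i; j'] [set j; j].
- by apply: disj; rewrite // eq_sym.
- by apply: leq_trans (c2 _ _) _.
- by rewrite setUid cards1; lia.
have := h A; have iA' : i \in val A by apply: (subsetP iA); rewrite !inE eqxx.
have jA' : j' \in val A by apply: (subsetP iA); rewrite !inE eqxx orbT.
have jA : j \in val A = false.
  by apply: (disjointFl dA); rewrite !inE eqxx.
by rewrite iA' jA' jA andbF.
Qed.

Definition separating_pairs A B : {set 'I_n * 'I_n} :=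
  setX (val A :&: val B) (~: (val A :|: val B)).

Lemma separating_pairsE A B (p : 'I_n * 'I_n) : (p \in separating_pairs A B) =
  ((p.1 \in val A) && (p.2 \notin val A)) && ((p.1 \in val B) && (p.2 \notin val B)).
Proof. by rewrite !inE negb_or andbACA. Qed.

(** The pairs separating both A and B inject into those separating their images. With x = |A :&: B|
    their number is x (n - 2k + x), which increases with x. *)
Lemma card_inter_le A B : #|val A :&: val B| <= #|val (t A) :&: val (t B)|.
Proof.
have /choice[s hs] : forall p : 'I_n * 'I_n, exists q : 'I_n * 'I_n, p.1 != p.2 ->
    q.1 != q.2 /\ forall A, (p.1 \in val A) && (p.2 \notin val A) =
      (q.1 \in val (t A)) && (q.2 \notin val (t A)).
  move=> p; have [_|/ht[u [v h]]] := eqVneq p.1 p.2; first by exists p.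
  by exists (u, v).
have neq p : p \in separating_pairs A B -> p.1 != p.2.
  rewrite separating_pairsE => /andP[/andP[p1 p2] _].
  by apply: contraNneq p2 => <-.
have sub : s @: separating_pairs A B \subset separating_pairs (t A) (t B).
  apply/subsetP => _ /imsetP[p pP ->]; have [_ h] := hs p (neq p pP).
  by rewrite separating_pairsE -!h -separating_pairsE.
have inj : {in separating_pairs A B &, injective s}.
  move=> [i j] [i' j'] /neq /= ij /neq /= ij' e.
  have [_ h] := hs (i, j) ij; have [_ h'] := hs (i', j') ij'.
  suff hh (C : T) : (i \in val C) && (j \notin val C) = (i' \in val C) && (j' \notin val C).
    by have [-> ->] := separating_inj ij ij' hh.
  by have := h C; have := h' C; rewrite e /= => -> ->.
have := subset_leq_card sub; rewrite card_in_imset // !cardsX.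
have card (X Y : T) : #|~: (val X :|: val Y)| + 2 * k = n + #|val X :&: val Y|.
  have := cardsUI (val X) (val Y); have := cardsC (val X :|: val Y).
  by rewrite !card_val card_ord; card_lia.
have := card A B; have := card (t A) (t B).
move: #|_| #|_| #|_| #|_| => x y z w e1 e2.
rewrite leqNgt => /negP h; rewrite leqNgt; apply/negP => lt; apply: h; nia.
Qed.

(** Since t permutes the vertices, both sides have the same sum over all pairs, so the termwise
    inequality is an equality. *)
Lemma card_inter_eq A B : #|val (t A) :&: val (t B)| = #|val A :&: val B|.
Proof.
pose F (p : T * T) := #|val p.1 :&: val p.2|.
pose tt (p : T * T) := (t p.1, t p.2).
have tt_inj : injective tt by move=> [a b] [c d] [/t_inj-> /t_inj->].
have le p : F p <= F (tt p) ?= iff (F p == F (tt p)).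
  by split => //; exact: card_inter_le.
have := leqif_sum (P := predT) (fun p _ => le p).
rewrite [\sum_p F (tt p)](_ : _ = \sum_p F p); last first.
  by rewrite [in RHS](reindex_inj tt_inj).
move=> [_]; rewrite eqxx => /esym/forallP/(_ (A, B)) /= /eqP e.
exact/esym.
Qed.

End Counting.

(** * J-mappings *)

Section JMapping.
Variables (R R' : unitRingType).
Hypotheses (hR : division_ring R) (hR' : division_ring R').
Variables (V : lmodType R) (V' : lmodType R') (n n' k k' : nat).
Hypotheses (hV : has_dim n [set: V]%classic) (hV' : has_dim n' [set: V']%classic).
Hypotheses (k_gt0 : 0 < k) (k'_gt0 : 0 < k').
Variable f : grassmannian V k -> grassmannian V' k'.
Hypothesis Jf : J_mapping n f.

Local Notation L := (subspace_lattice hR' hV').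
Local Notation T := {A : {set 'I_n} | #|A| == k}.
Implicit Types (b : 'I_n -> V).

Definition image_vertex b (hb : is_basis [set: V]%classic b) (A : T) : L :=
  vertex_subspace hR' hV' (f (johnson_vertex hR hb.1 A)).

(** The apartment and its image are indexed by the same finite set of k-subsets. Hence f, being onto
    the J-subset, induces a surjective and so injective map t of indices. *)
Lemma apartment_data b (hb : is_basis [set: V]%classic b) :
  exists (g : {set 'I_n} -> L) (t : T -> T),
    [/\ isoJ k k' g, injective t & forall A, image_vertex hb A = g (val (t A))].
Proof.
pose jv : T -> grassmannian V k := johnson_vertex hR hb.1.
pose Ap : set (grassmannian V k) :=
  [set S | exists I : {set 'I_n}, val S = lspan (b @` [set` I])]%classic.
have hAp : apartment n Ap by exists b.
have [g0 /(isometric_embeddingE _ (johnson_distE k_gt0) (grassmann_distE hR' hV' k'_gt0))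
  [g0_inj g0_iso] eg0] := Jf hAp.
have /choice[t ht] : forall A : T, exists B : T, f (jv A) = g0 B.
  move=> A; have : (f @` Ap)%classic (f (jv A)) by exists (jv A) => //; exists (val A).
  by rewrite eg0 => -[B _ <-]; exists B.
have t_surj B : exists A, t A = B.
  have : range g0 (g0 B) by exists B.
  rewrite -eg0 => -[S [I eS] efS].
  have cI : #|I| == k.
    apply/eqP; apply: (has_dim_uniq hR _ (grassmannian_dim S)); rewrite eS.
    exact: (vspan_dim hR _ hb.1).
  exists (exist _ I cI); apply: g0_inj; rewrite -ht -efS; congr f.
  by apply: val_inj; rewrite eS.
(* Index sets of size other than k receive the zero subspace as a junk value. *)
exists (fun I => if insub I is Some B then vertex_subspace hR' hV' (g0 B)
                 else exist _ _ (lspan_subspace (@classical_sets.set0 V'))), t; split.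
- move=> I J /eqP cI /eqP cJ; rewrite !insubT rk_vertex; split => //=.
  have := g0_iso (exist _ I cI) (exist _ J cJ).
  rewrite /grassmann_delta /johnson_delta /=.
  have := grassmann_dim_le hR' hV' (g0 (exist _ I cI)) (g0 (exist _ J cJ)).
  have := subset_leq_card (subsetIl I J); rewrite (eqP cI).
  move: (dim _) => x; card_lia.
- exact: surjective_injective.
- by move=> A; rewrite valK /image_vertex -ht.
Qed.

Lemma J_mapping_inj : injective f.
Proof.
move=> S U e; have [b [indep hb [A [B [eS eU]]]]] := common_apartment hR hV S U.
have [g [t [iso t_inj ht]]] := apartment_data hb.
have {}eS : S = johnson_vertex hR hb.1 A by rewrite eS; apply: val_inj.
have {}eU : U = johnson_vertex hR hb.1 B by rewrite eU; apply: val_inj.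
rewrite eS eU; congr johnson_vertex; apply: t_inj; apply: val_inj.
apply: (isoJ_inj iso); rewrite ?card_val // -!ht /image_vertex -eS -eU e //.
Qed.

Lemma image_vertex_eq b b' (hb : is_basis [set: V]%classic b)
    (hb' : is_basis [set: V]%classic b') (A B : T) :
  image_vertex hb A = image_vertex hb' B <-> vspan b (val A) = vspan b' (val B).
Proof.
split=> [/vertex_subspace_inj/J_mapping_inj/(congr1 val)//|e].
by congr vertex_subspace; congr f; apply: val_inj.
Qed.

Lemma image_of_vertex b (hb : is_basis [set: V]%classic b) (g : {set 'I_n} -> L) (t : T -> T) :
  injective t -> (forall A, image_vertex hb A = g (val (t A))) ->
  forall x, image_of k g x <-> exists A, image_vertex hb A = x.
Proof.
move=> t_inj ht x; split=> [[I /eqP cI <-]|[A <-]]; last first.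
  by exists (val (t A)); rewrite ?card_val // ht.
by exists (invF t_inj (exist _ I cI)); rewrite ht f_invF.
Qed.

Section Nontrivial.
Hypotheses (k_gt1 : 1 < k) (lt_k : k + 2 <= n).

Lemma separating_transvection i j b b' (hb : is_basis [set: V]%classic b)
    (hb' : is_basis [set: V]%classic b') a : i != j -> a != 0%R -> transvection i j a b b' ->
  exists A, forall B, image_vertex hb' B <> image_vertex hb A.
Proof.
move=> ij a0 tr; have [|||A [iA dA]] := @separating_set n k [set i] [set j].
- by rewrite disjoints_subset sub1set !inE.
- by rewrite cards1; lia.
- by rewrite cards1; lia.
have iA' : i \in val A by rewrite -sub1set.
have jA : j \notin val A by rewrite (disjointFl dA) // set11.
exists A => B /image_vertex_eq/esym.
exact: (transvection_neq ij a0 tr hb.1 hb'.1 iA' jA).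
Qed.

Definition separated i j : {set T} := [set A : T | (i \in val A) && (j \notin val A)].

Lemma card_separated i j : i != j -> #|separated i j| = 'C(n.-2, k.-1).
Proof.
move=> ij; rewrite -(card_separating _ ij) prednK // -(card_imset _ val_inj).
congr #|pred_of_set _|; apply/setP => I; apply/imsetP/idP.
  by move=> [A]; rewrite !inE => hA ->; rewrite card_val eqxx.
by rewrite inE => /andP[cI hI]; exists (exist _ I cI); rewrite ?inE.
Qed.

Lemma outside_bound b b' (hb : is_basis [set: V]%classic b) (hb' : is_basis [set: V]%classic b')
    (g g' : {set 'I_n} -> L) (t t' : T -> T) i j : i != j -> injective t -> injective t' ->
  (forall A, image_vertex hb A = g (val (t A))) ->
  (forall A, image_vertex hb' A = g' (val (t' A))) ->
  (forall A, A \notin separated i j -> exists B, image_vertex hb' B = image_vertex hb A) ->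
  #|outside k g g'| <= 'C(n.-2, k.-1).
Proof.
move=> ij t_inj t'_inj ht ht' h; rewrite -(card_separated ij).
apply: leq_trans (leq_imset_card (fun A : T => val (t A)) (mem (separated i j))).
apply: subset_leq_card; apply/subsetP => I.
rewrite inE => /andP[cI /asboolPn nI].
pose A := invF t_inj (exist _ I cI); have tA : t A = exist _ I cI by rewrite f_invF.
apply/imsetP; exists A; last by rewrite tA.
apply/negPn/negP => /h hA; apply: nI; apply/(image_of_vertex t'_inj ht').
by case: hA => B eB; exists B; rewrite eB ht tA.
Qed.

(** [exchange] is applied to the images of the apartments of b, b' and b''; the preimage under t of
    the separated set it yields is then compared with [separated i j]. *)
Lemma separated_preserved b (hb : is_basis [set: V]%classic b) (g : {set 'I_n} -> L) (t : T -> T) :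
  isoJ k k' g -> injective t -> (forall A, image_vertex hb A = g (val (t A))) ->
  forall i j, i != j -> exists u v, u != v /\
  forall A : T, (i \in val A) && (j \notin val A) = (u \in val (t A)) && (v \notin val (t A)).
Proof.
move=> iso t_inj ht i j ij.
have one0 : 1%R != 0%R :> R by exact: oner_neq0.
have ji : j != i by rewrite eq_sym.
have [b' tr] := transvection_exists i j 1%R b.
have [b'' tr2] := transvection_exists j i 1%R b.
have hb' := transvection_basis ij tr hb; have hb'' := transvection_basis ji tr2 hb.
have [g' [t' [iso' t'_inj ht']]] := apartment_data hb'.
have [g'' [t'' [iso'' t''_inj ht'']]] := apartment_data hb''.
have im := image_of_vertex t_inj ht.
have im' := image_of_vertex t'_inj ht'; have im'' := image_of_vertex t''_inj ht''.
have adm x y (A : T) : A \notin separated x y -> x \notin val A \/ y \in val A.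
  by rewrite inE negb_and negbK => /orP.
have eq1 A : A \notin separated i j -> image_vertex hb' A = image_vertex hb A.
  by move=> /adm h; apply/image_vertex_eq; exact: transvection_vspan ij tr h.
have eq2 A : A \notin separated j i -> image_vertex hb'' A = image_vertex hb A.
  by move=> /adm h; apply/image_vertex_eq; exact: transvection_vspan ji tr2 h.
have anti x y (A : T) : A \in separated x y -> A \notin separated y x.
  by rewrite !inE => /andP[-> /negPf->].
have swap x y (A : T) : A \in separated x y -> #|y |: val A :\ x| == k.
  rewrite inE => /andP[xA yA]; rewrite cardsU1 !inE (negPf yA) andbF.
  by apply/eqP/esym; have := cardsD1 x (val A); rewrite xA card_val.
have eq3 A : A \in separated i j -> exists B, image_vertex hb'' B = image_vertex hb' A.
  move=> sA; exists (exist (fun I : {set 'I_n} => #|I| == k) _ (swap _ _ _ sA)); apply/image_vertex_eq/esym => /=.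
  by move: sA; rewrite inE => /andP[]; exact: (transvection_swap ij tr tr2).
have eq4 A : A \in separated j i -> exists B, image_vertex hb' B = image_vertex hb'' A.
  move=> sA; exists (exist (fun I : {set 'I_n} => #|I| == k) _ (swap _ _ _ sA)); apply/image_vertex_eq/esym => /=.
  by move: sA; rewrite inE => /andP[]; exact: (transvection_swap ji tr2 tr).
have vtx (d : 'I_n -> V) (hd : is_basis [set: V]%classic d) (h : {set 'I_n} -> L) (s : T -> T) :
    injective s -> (forall A, image_vertex hd A = h (val (s A))) ->
    forall I : {set 'I_n}, #|I| = k -> exists A, h I = image_vertex hd A.
  move=> s_inj hs I /eqP cI; exists (invF s_inj (exist _ I cI)).
  by rewrite hs f_invF.
have [||||||u [v [uv huv]]] := @exchange n k L k' g g' g'' k_gt1 lt_k iso iso' iso''.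
- move=> I /(vtx _ _ _ _ t_inj ht)[A ->]; have [sA|sA] := boolP (A \in separated i j).
    by right; apply/im''; exists A; rewrite eq2 ?anti.
  by left; apply/im'; exists A; rewrite eq1.
- move=> I /(vtx _ _ _ _ t'_inj ht')[A ->]; have [sA|sA] := boolP (A \in separated i j).
    by right; apply/im''; have [B eB] := eq3 A sA; exists B.
  by left; apply/im; exists A; rewrite eq1.
- have [A hA] := separating_transvection hb hb' ij one0 tr; exists (val (t A)).
  by rewrite card_val -ht; split => // /im'[B]; exact: hA.
- have one0' : (- 1)%R != 0%R :> R by rewrite oppr_eq0.
  have [A hA] := separating_transvection hb' hb ij one0' (transvection_sym ij tr).
  by exists (val (t' A)); rewrite card_val -ht'; split => // /im[B]; exact: hA.
- apply: (outside_bound ij t''_inj t'_inj ht'' ht') => A sA.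
  have [sA'|sA'] := boolP (A \in separated j i); first exact: eq4.
  by exists A; rewrite eq1 // eq2.
- apply: (outside_bound ji t''_inj t_inj ht'' ht) => A sA.
  by exists A; rewrite eq2.
exists u, v; split => //; suff e : t @^-1: separated u v = separated i j.
  by move=> A; have /setP/(_ A) := e; rewrite !inE => ->.
(* Both sets have 'C(n - 2, k - 1) elements, so one inclusion suffices: outside [separated i j] the
   vertex is shared with b', which [huv] forbids. *)
apply/eqP; rewrite eqEcard; apply/andP; split; last first.
  by rewrite card_preimset // !card_separated.
apply/subsetP => A; rewrite inE => tA; apply/negPn/negP => /eq1 e.
move: tA; rewrite inE => /andP[uA vA]; apply: (huv _ (card_val (t A)) uA vA).
by apply/im'; exists A; rewrite e ht.
Qed.

End Nontrivial.

Lemma card_inter_preserved b (hb : is_basis [set: V]%classic b) (g : {set 'I_n} -> L) (t : T -> T) :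
  k < n -> isoJ k k' g -> injective t -> (forall A, image_vertex hb A = g (val (t A))) ->
  forall A B : T, #|val (t A) :&: val (t B)| = #|val A :&: val B|.
Proof.
move=> lt_kn iso t_inj ht A B.
have [/andP[k_gt1 le_k]|small] := boolP ((1 < k) && (k + 2 <= n)).
  by apply: card_inter_eq => //; exact: separated_preserved ht.
(* When k = 1 or k = n - 1 any two distinct vertices of J(n,k) are adjacent. *)
have inter (C D : T) : C != D -> #|val C :&: val D| = k.-1.
  move=> CD; have lt_k : #|val C :&: val D| < k.
    rewrite ltnNge; apply: contra CD => le_k; apply/eqP/val_inj/eqP.
    rewrite eqEcard !card_val leqnn andbT.
    by apply/setIidPl/eqP; rewrite eqEcard subsetIl card_val.
  have := cardsUI (val C) (val D); have := max_card (mem (val C :|: val D)).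
  rewrite card_ord !card_val; move: small; rewrite negb_and -!leqNgt -ltnNge.
  by move: lt_k; move: #|_| #|_| => x y; lia.
have [->|AB] := eqVneq A B; first by rewrite !setIid !card_val.
by rewrite !inter // (inj_eq t_inj).
Qed.

End JMapping.

Theorem theorem3p1 (R R' : unitRingType)
    (hR : division_ring R) (hR' : division_ring R')
    (V : lmodType R) (V' : lmodType R')
    (n n' k k' : nat)
    (hV : has_dim n [set: V]%classic) (hV' : has_dim n' [set: V']%classic)
    (hk : (1 <= k <= n - 1)%N) (hk' : (1 <= k' <= n' - 1)%N)
    (f : grassmannian V k -> grassmannian V' k') :
  J_mapping n f ->
  isometric_embedding (grassmann_adj V k) (grassmann_adj V' k') f.
Proof.
move=> Jf; have [k_gt0 k'_gt0 lt_kn] : [/\ 0 < k, 0 < k' & k < n] by split; lia.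
apply/(isometric_embeddingE _ (grassmann_distE hR hV k_gt0) (grassmann_distE hR' hV' k'_gt0)).
split=> [|S U]; first exact: (J_mapping_inj hR hR' hV hV' k_gt0 k'_gt0 Jf).
have [b [indep hb [A [B [eS eU]]]]] := common_apartment hR hV S U.
have [g [t [iso t_inj ht]]] := apartment_data hR hR' hV' k_gt0 k'_gt0 Jf hb.
have {}eS : S = johnson_vertex hR hb.1 A by rewrite eS; apply: val_inj.
have {}eU : U = johnson_vertex hR hb.1 B by rewrite eU; apply: val_inj.
have inter := card_inter_preserved hV k_gt0 k'_gt0 Jf lt_kn iso t_inj ht A B.
(* The intersection of the images has dimension k' - k + |A :&: B|, so its defect from k' is the
   Johnson distance of A and B, which is the Grassmann distance of S and U. *)
have := isoJ_meet iso (card_val (t A)) (card_val (t B)); rewrite -!ht inter.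
rewrite {2}eS {2}eU johnson_vertex_delta /grassmann_delta /johnson_delta eS eU /=.
have : #|val A :&: val B| <= k by apply: leq_trans (subset_leq_card (subsetIl _ _)) _; rewrite card_val.
by move: (dim _) => x; card_lia.
Qed.
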